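(* Let $n\in\mathbb{N}$ ($n=0$ allowed), $z_0\in\mathbb{D}$ and $\gamma=(\gamma_0,\ldots,\gamma_n)\in\overline{\mathbb{D}}^{\,n+1}$, and let $$\mathcal{S}(\gamma)=\{f\in\mathcal{S}: f(z_0)=\gamma_0,\ H^1f(z_0)=\gamma_1,\ \ldots,\ H^nf(z_0)=\gamma_n\}.$$ Then: (1) If $|\gamma_0|<1,\ldots,|\gamma_n|<1$, then $\mathcal{S}(\gamma)$ is exactly the set of functions of the form $$f(z)=T_{\gamma_0}(T_{-z_0}(z)\,T_{\gamma_1}(\cdots T_{-z_0}(z)\,T_{\gamma_n}(T_{-z_0}(z)f^*(z))\cdots)),$$ where $f^*\in\mathcal{S}$ is arbitrary. (2) If $|\gamma_0|<1,\ldots,|\gamma_{j-1}|<1$, $|\gamma_j|=1$, $\gamma_{j+1}=\cdots=\gamma_n=0$ for some $j\in\{0,\ldots,n\}$, then $\mathcal{S}(\gamma)$ consists of the single function $$f(z)=T_{\gamma_0}(T_{-z_0}(z)\,T_{\gamma_1}(\cdots T_{-z_0}(z)\,T_{\gamma_{j-1}}(\gamma_jT_{-z_0}(z))\cdots))$$ (for $j=0$ this is read as the constant $f\equiv\gamma_0$), which is a Blaschke product of degree $j$. (3) In all other cases, $\mathcal{S}(\gamma)=\emptyset$.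
   Context: $\mathbb{D}=\{|z|<1\}$; $\mathcal{S}$ is the Schur class of analytic functions $f$ on $\mathbb{D}$ with $|f|\le1$. For $a\in\mathbb{D}$, $T_a(z)=(z+a)/(1+\bar az)$. For $z,w\in\overline{\mathbb{D}}$ with $z\overline w\neq1$, $[z,w]=\frac{z-w}{1-\overline wz}$. For $z_0\in\mathbb{D}$, the operator $\Delta_{z_0}:\mathcal{S}\to\mathcal{S}$ is given by $\Delta_{z_0}f(z)=\frac{[f(z),f(z_0)]}{[z,z_0]}$ for $z\neq z_0$ and $\Delta_{z_0}f(z_0)=\frac{(1-|z_0|^2)f'(z_0)}{1-|f(z_0)|^2}$ if $f$ is not a unimodular constant, with the convention $\Delta_{z_0}f\equiv0$ if $f$ is a unimodular constant. The hyperbolic derivative of order $j$ of $f$ at $z_0$ is $H^jf(z_0)=(\Delta_{z_0}^jf)(z_0)$, where $\Delta_{z_0}^j$ is the $j$-fold iterate of $\Delta_{z_0}$. A (finite) Blaschke product of degree $m$ is a function $e^{i\theta}\prod_{l=1}^m\frac{z-a_l}{1-\overline{a_l}z}$ with $\theta\in\mathbb{R}$, $a_l\in\mathbb{D}$. *)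

(* Defs.v *)
From Stdlib Require Import Reals List ClassicalEpsilon.
From Coquelicot Require Import Coquelicot.

Open Scope R_scope.
Open Scope C_scope.

(* Functions on the unit disc are represented by total functions [C -> C] of
   which only the values on the disc matter; equality of functions is
   [eq_on_disc]. *)
Definition in_disc (z : C) : Prop := (Cmod z < 1)%R.
Definition in_closed_disc (z : C) : Prop := (Cmod z <= 1)%R.

Definition eq_on_disc (f g : C -> C) : Prop :=
  forall z : C, in_disc z -> f z = g z.

Definition analytic_on_disc (f : C -> C) : Prop :=
  forall z : C, in_disc z -> @ex_derive C_AbsRing C_NormedModule f z.

Definition schur_class (f : C -> C) : Prop :=
  analytic_on_disc f /\ forall z : C, in_disc z -> (Cmod (f z) <= 1)%R.

Definition mobius (a z : C) : C := (z + a) / (1 + Cconj a * z).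

Definition bracket (z w : C) : C := (z - w) / (1 - Cconj w * z).

Definition unimodular_constant (f : C -> C) : Prop :=
  exists c : C, Cmod c = 1%R /\ forall z : C, in_disc z -> f z = c.

Definition Delta (z0 : C) (f : C -> C) (z : C) : C :=
  if excluded_middle_informative (unimodular_constant f) then 0
  else if Ceq_dec z z0 then
    RtoC (1 - Cmod z0 ^ 2) * C_derive f z0 / RtoC (1 - Cmod (f z0) ^ 2)
  else bracket (f z) (f z0) / bracket z z0.

Definition hyp_derive (j : nat) (f : C -> C) (z0 : C) : C :=
  Nat.iter j (Delta z0) f z0.

(* For j = 0 the condition reads f z0 = gamma 0. *)
Definition schur_interp (n : nat) (z0 : C) (gamma : nat -> C) (f : C -> C)
  : Prop :=
  schur_class f /\
  forall j : nat, (j <= n)%nat -> hyp_derive j f z0 = gamma j.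

(* [schur_nest z0 gamma m g z] is, with [T a := mobius a] and
   [t := mobius (- z0) z],
   T (gamma 0) (t * T (gamma 1) (... t * T (gamma (m-1)) (t * g z) ...)),
   and [g z] when [m = 0]. *)
Fixpoint schur_nest (z0 : C) (gamma : nat -> C) (m : nat) (g : C -> C) (z : C)
  : C :=
  match m with
  | O => g z
  | S m' =>
      mobius (gamma O)
        (mobius (- z0) z * schur_nest z0 (fun k => gamma (S k)) m' g z)
  end.

Definition blaschke_product (m : nat) (f : C -> C) : Prop :=
  exists (theta : R) (a : list C),
    List.length a = m /\ List.Forall in_disc a /\
    forall z : C, in_disc z ->
      f z = (cos theta, sin theta) *
            List.fold_right Cmult 1
              (List.map (fun al => (z - al) / (1 - Cconj al * z)) a).

Definition all_interior (n : nat) (gamma : nat -> C) : Prop :=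
  forall k : nat, (k <= n)%nat -> (Cmod (gamma k) < 1)%R.

Definition boundary_at (n : nat) (gamma : nat -> C) (j : nat) : Prop :=
  (j <= n)%nat /\
  (forall k : nat, (k < j)%nat -> (Cmod (gamma k) < 1)%R) /\
  Cmod (gamma j) = 1%R /\
  (forall k : nat, (j < k <= n)%nat -> gamma k = 0).

(* Main.v *)
(* Schur's algorithm.  If [f] is in the Schur class with [|f z0| < 1], then composing
   with disc automorphisms to bring [z0] and [f z0] to [0] and applying the Schwarz
   lemma gives [f = T_(f z0) (T_(-z0) * g)] with [g] in the Schur class, and
   [g = Delta z0 f] on the disc; so a prescribed hyperbolic derivative of order [j + 1]
   of [f] is one of order [j] of [g], and everything follows by induction.  If
   [|f z0| = 1], then [f] is constant and all later hyperbolic derivatives vanish.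

   The Schwarz lemma needs Cauchy's theorem for functions that are only assumed
   complex differentiable: by Goursat's theorem applied to [k (exp w)], circle means
   of [k] do not depend on the radius, whence the mean value property for [k]
   continuous and differentiable off the origin and off one circle.  Applied to
   [z * (g z - g a) / (z - a)] it yields Cauchy's formula for [g], the removable
   singularity at [0] and the maximum principle. *)

Require Import Defs.
From Stdlib Require Import Reals List.
From Coquelicot Require Import Coquelicot.
From Stdlib Require Import Lra Lia ClassicalEpsilon Classical FunctionalExtensionality.

Local Open Scope C_scope.

(** * Complex differentiability *)

(** Two points of weak regularity shape the integral part. The exponential omits 0, so its annuli
    reach the origin only in the limit, and the mean value property asks for mere continuity there;
    this is all that is known at first of [k z / z] in the Schwarz lemma. A difference quotient is
    likewise only known to be continuous at its centre [a], hence the exceptional circle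
    [|z| = |a|]; the extra factor [z] makes the value at 0, and therefore the mean, vanish. The
    degree claim for the boundary case is a separate problem: the nested formula has to become a
    product of exactly [j] factors, so [T_c] of a Blaschke product must be factored explicitly. Its
    numerator is a polynomial, split by the fundamental theorem of algebra, which again rests on the
    maximum principle; a reflection in the unit circle then shows that the denominator consists of
    the matching factors. Since functions are total but matter only on the disc, every inductive
    statement is kept stable under [eq_on_disc]. *)

Definition cderiv (f : C -> C) (z l : C) : Prop :=
  forall eps : R, (0 < eps)%R -> exists d : R, (0 < d)%R /\
    forall w : C, (Cmod (w - z) < d)%R ->
      (Cmod (f w - f z - l * (w - z)) <= eps * Cmod (w - z))%R.

Definition ccont (f : C -> C) (z : C) : Prop :=
  forall eps : R, (0 < eps)%R -> exists d : R, (0 < d)%R /\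
    forall w : C, (Cmod (w - z) < d)%R -> (Cmod (f w - f z) < eps)%R.

Lemma Cmod_minus_sym (a b : C) : Cmod (a - b) = Cmod (b - a).
Proof. rewrite <- Cmod_opp; f_equal; ring. Qed.

Lemma Cmod_minus_self (a : C) : Cmod (a - a) = 0%R.
Proof. replace (a - a) with (RtoC 0) by ring; apply Cmod_0. Qed.

Lemma Cmod_triang_via (a b c : C) : (Cmod (a - c) <= Cmod (a - b) + Cmod (b - c))%R.
Proof.
replace (a - c) with ((a - b) + (b - c)) by ring; apply Cmod_triangle.
Qed.

Lemma Cmod_rev_triang (a b : C) : (Cmod a - Cmod b <= Cmod (a - b))%R.
Proof.
pose proof (Cmod_triangle (a - b) b) as H.
replace (a - b + b) with a in H by ring. lra.
Qed.

Lemma Cmod_rev_triang_plus (a b : C) : (Cmod a - Cmod b <= Cmod (a + b))%R.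
Proof.
pose proof (Cmod_rev_triang a (- b)) as H; rewrite Cmod_opp in H.
replace (a - - b) with (a + b) in H by ring; exact H.
Qed.

(** Bridge between Coquelicot's filter formulation, on which [schur_class] rests, and the epsilon
    form in which all estimates are made. The latter avoids division, so [w = z] needs no
    exclusion. *)
Lemma is_derive_cderiv (f : C -> C) (z l : C) :
  @is_derive C_AbsRing C_NormedModule f z l <-> cderiv f z l.
Proof.
split.
- intros [_ H] eps heps.
  specialize (H z (fun P HP => HP) (mkposreal eps heps)).
  destruct H as [d Hd].
  exists (pos d); split; [apply cond_pos|].
  intros w hw; specialize (Hd w hw).
  change (Cmod (f w - f z - (w - z) * l) <= eps * Cmod (w - z))%R in Hd.
  rewrite (Cmult_comm l); exact Hd.
- intros H; split; [apply is_linear_scal_l|].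
  intros x Hx.
  assert (E : x = z)
    by (symmetry; exact (@is_filter_lim_locally_unique C_AbsRing
                           (AbsRing_NormedModule C_AbsRing) z x Hx)).
  subst x; intros [eps heps].
  destruct (H eps heps) as [d [hd Hd]].
  exists (mkposreal d hd); intros w hw; simpl.
  specialize (Hd w hw); rewrite (Cmult_comm l) in Hd; exact Hd.
Qed.

Lemma cderiv_C_derive (f : C -> C) (z l : C) : cderiv f z l -> C_derive f z = l.
Proof. intros H; apply is_C_derive_unique, is_derive_cderiv, H. Qed.

Lemma ex_derive_cderiv (f : C -> C) (z : C) :
  @ex_derive C_AbsRing C_NormedModule f z <-> exists l, cderiv f z l.
Proof.
split; intros [l H]; exists l; apply is_derive_cderiv; exact H.
Qed.

Lemma cderiv_eq (f : C -> C) (z l m : C) : cderiv f z l -> l = m -> cderiv f z m.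
Proof. intros H <-; exact H. Qed.

Lemma cderiv_ext_loc (f g : C -> C) (z l : C) (d : R) :
  (0 < d)%R -> (forall w, (Cmod (w - z) < d)%R -> f w = g w) ->
  cderiv f z l -> cderiv g z l.
Proof.
intros hd E H eps heps; destruct (H eps heps) as [d' [hd' H']].
exists (Rmin d d'); split; [apply Rmin_glb_lt; assumption|].
intros w hw.
rewrite <- (E w), <- (E z).
- apply H'. eapply Rlt_le_trans; [exact hw|apply Rmin_r].
- rewrite Cmod_minus_self; exact hd.
- eapply Rlt_le_trans; [exact hw|apply Rmin_l].
Qed.

Lemma ccont_ext_loc (f g : C -> C) (z : C) (d : R) :
  (0 < d)%R -> (forall w, (Cmod (w - z) < d)%R -> f w = g w) ->
  ccont f z -> ccont g z.
Proof.
intros hd E H eps heps; destruct (H eps heps) as [d' [hd' H']].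
exists (Rmin d d'); split; [apply Rmin_glb_lt; assumption|].
intros w hw.
rewrite <- (E w), <- (E z).
- apply H'. eapply Rlt_le_trans; [exact hw|apply Rmin_r].
- rewrite Cmod_minus_self; exact hd.
- eapply Rlt_le_trans; [exact hw|apply Rmin_l].
Qed.

Lemma cderiv_lip (f : C -> C) (z l : C) : cderiv f z l ->
  exists d, (0 < d)%R /\ forall w, (Cmod (w - z) < d)%R ->
    (Cmod (f w - f z) <= (Cmod l + 1) * Cmod (w - z))%R.
Proof.
intros H; destruct (H 1%R Rlt_0_1) as [d [hd Hd]]; exists d; split; [exact hd|].
intros w hw; specialize (Hd w hw).
replace (f w - f z) with ((f w - f z - l * (w - z)) + l * (w - z)) by ring.
eapply Rle_trans; [apply Cmod_triangle|]; rewrite Cmod_mult; lra.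
Qed.

Lemma cderiv_ccont (f : C -> C) (z l : C) : cderiv f z l -> ccont f z.
Proof.
intros H eps heps; destruct (cderiv_lip _ _ _ H) as [d [hd Hd]].
pose proof (Cmod_ge_0 l) as hl.
exists (Rmin d (eps / (Cmod l + 1))); split.
- apply Rmin_glb_lt; [exact hd|apply Rdiv_lt_0_compat; lra].
- intros w hw.
  eapply Rle_lt_trans;
    [apply Hd; eapply Rlt_le_trans; [exact hw|apply Rmin_l]|].
  assert (h : (Cmod (w - z) < eps / (Cmod l + 1))%R)
    by (eapply Rlt_le_trans; [exact hw|apply Rmin_r]).
  apply (Rmult_lt_compat_l (Cmod l + 1)) in h; [|lra].
  replace ((Cmod l + 1) * (eps / (Cmod l + 1)))%R with eps in h by (field; lra).
  exact h.
Qed.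

Lemma cderiv_const (c z : C) : cderiv (fun _ => c) z 0.
Proof.
intros eps heps; exists 1%R; split; [lra|]; intros w _.
replace (c - c - 0 * (w - z)) with (RtoC 0) by ring; rewrite Cmod_0.
apply Rmult_le_pos; [lra|apply Cmod_ge_0].
Qed.

Lemma cderiv_id (z : C) : cderiv (fun w => w) z 1.
Proof.
intros eps heps; exists 1%R; split; [lra|]; intros w _.
replace (w - z - 1 * (w - z)) with (RtoC 0) by ring; rewrite Cmod_0.
apply Rmult_le_pos; [lra|apply Cmod_ge_0].
Qed.

Lemma cderiv_plus (f g : C -> C) (z l m : C) :
  cderiv f z l -> cderiv g z m -> cderiv (fun w => f w + g w) z (l + m).
Proof.
intros Hf Hg eps heps.
destruct (Hf (eps / 2)%R ltac:(lra)) as [d1 [hd1 H1]].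
destruct (Hg (eps / 2)%R ltac:(lra)) as [d2 [hd2 H2]].
exists (Rmin d1 d2); split; [apply Rmin_glb_lt; assumption|]; intros w hw.
specialize (H1 w (Rlt_le_trans _ _ _ hw (Rmin_l _ _))).
specialize (H2 w (Rlt_le_trans _ _ _ hw (Rmin_r _ _))).
replace (f w + g w - (f z + g z) - (l + m) * (w - z))
  with ((f w - f z - l * (w - z)) + (g w - g z - m * (w - z))) by ring.
eapply Rle_trans; [apply Cmod_triangle|]; lra.
Qed.

Lemma cderiv_comp (f g : C -> C) (z l m : C) :
  cderiv f (g z) l -> cderiv g z m -> cderiv (fun w => f (g w)) z (l * m).
Proof.
intros Hf Hg eps heps.
destruct (cderiv_lip _ _ _ Hg) as [d1 [hd1 H1]].
pose proof (Cmod_ge_0 l) as hl; pose proof (Cmod_ge_0 m) as hm.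
assert (he1 : (0 < eps / (2 * (Cmod m + 1)))%R) by (apply Rdiv_lt_0_compat; lra).
destruct (Hf _ he1) as [d2 [hd2 H2]].
assert (he2 : (0 < eps / (2 * (Cmod l + 1)))%R) by (apply Rdiv_lt_0_compat; lra).
destruct (Hg _ he2) as [d3 [hd3 H3]].
destruct (cderiv_ccont _ _ _ Hg d2 hd2) as [d4 [hd4 H4]].
exists (Rmin (Rmin d1 d3) d4); split.
- repeat apply Rmin_glb_lt; assumption.
- intros w hw.
  assert (hw1 : (Cmod (w - z) < d1)%R)
    by (eapply Rlt_le_trans; [exact hw|];
        eapply Rle_trans; [apply Rmin_l|apply Rmin_l]).
  assert (hw3 : (Cmod (w - z) < d3)%R)
    by (eapply Rlt_le_trans; [exact hw|];
        eapply Rle_trans; [apply Rmin_l|apply Rmin_r]).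
  assert (hw4 : (Cmod (w - z) < d4)%R)
    by (eapply Rlt_le_trans; [exact hw|apply Rmin_r]).
  specialize (H1 w hw1); specialize (H3 w hw3); specialize (H4 w hw4).
  specialize (H2 (g w) H4).
  replace (f (g w) - f (g z) - l * m * (w - z))
    with ((f (g w) - f (g z) - l * (g w - g z)) + l * (g w - g z - m * (w - z)))
    by ring.
  eapply Rle_trans; [apply Cmod_triangle|]; rewrite Cmod_mult.
  pose proof (Cmod_ge_0 (w - z)) as hwz.
  assert (A1 : (Cmod (f (g w) - f (g z) - l * (g w - g z))
                <= eps / 2 * Cmod (w - z))%R).
  { eapply Rle_trans; [exact H2|].
    eapply Rle_trans; [apply Rmult_le_compat_l; [lra|exact H1]|].
    right; field; lra. }
  assert (A2 : (Cmod l * Cmod (g w - g z - m * (w - z))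
                <= eps / 2 * Cmod (w - z))%R).
  { eapply Rle_trans; [apply Rmult_le_compat_l; [lra|exact H3]|].
    replace (eps / 2 * Cmod (w - z))%R
      with ((Cmod l + 1) * (eps / (2 * (Cmod l + 1)) * Cmod (w - z)))%R
      by (field; lra).
    apply Rmult_le_compat_r; [|lra].
    apply Rmult_le_pos; lra. }
  lra.
Qed.

Lemma cderiv_scal (c : C) (f : C -> C) (z l : C) :
  cderiv f z l -> cderiv (fun w => c * f w) z (c * l).
Proof.
intros Hf.
apply (cderiv_comp (fun u => c * u) f z c l); [|exact Hf].
intros eps heps; exists 1%R; split; [lra|]; intros w _.
replace (c * w - c * f z - c * (w - f z)) with (RtoC 0) by ring; rewrite Cmod_0.
apply Rmult_le_pos; [lra|apply Cmod_ge_0].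
Qed.

Lemma cderiv_sqr (z : C) : cderiv (fun w => w * w) z (z + z).
Proof.
intros eps heps; exists eps; split; [exact heps|]; intros w hw.
replace (w * w - z * z - (z + z) * (w - z)) with ((w - z) * (w - z)) by ring.
rewrite Cmod_mult; apply Rmult_le_compat_r; [apply Cmod_ge_0|lra].
Qed.

Lemma cderiv_mult (f g : C -> C) (z l m : C) :
  cderiv f z l -> cderiv g z m ->
  cderiv (fun w => f w * g w) z (l * g z + f z * m).
Proof.
intros Hf Hg.
(* Polarization: [f g = ((f + g)^2 - f^2 - g^2) / 2]. *)
assert (H : cderiv (fun w => / 2 * ((f w + g w) * (f w + g w)
                   + ((-1) * (f w * f w) + (-1) * (g w * g w)))) z
           (/ 2 * ((f z + g z + (f z + g z)) * (l + m)
             + ((-1) * ((f z + f z) * l) + (-1) * ((g z + g z) * m))))).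
{ apply cderiv_scal, cderiv_plus; [|apply cderiv_plus; apply cderiv_scal].
  - apply (cderiv_comp (fun u => u * u) (fun w => f w + g w));
      [apply cderiv_sqr|apply cderiv_plus; assumption].
  - apply (cderiv_comp (fun u => u * u) f); [apply cderiv_sqr|assumption].
  - apply (cderiv_comp (fun u => u * u) g); [apply cderiv_sqr|assumption]. }
assert (h2 : RtoC 2 <> 0) by (intros E; apply RtoC_inj in E; lra).
replace (l * g z + f z * m)
  with (/ 2 * ((f z + g z + (f z + g z)) * (l + m)
             + ((-1) * ((f z + f z) * l) + (-1) * ((g z + g z) * m))))
  by (field; exact h2).
eapply cderiv_ext_loc; [apply Rlt_0_1| |exact H].
intros w _; simpl; field; exact h2.
Qed.

Lemma cderiv_Cinv (z : C) : z <> 0 -> cderiv Cinv z (- / (z * z)).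
Proof.
intros hz eps heps.
assert (hm : (0 < Cmod z)%R) by (apply Cmod_gt_0, hz).
set (M := Cmod z) in *.
(* The remainder is exactly [(w - z)^2 / (z^2 * w)]. The radius [M / 2] keeps [|w| >= M / 2], and
   the second radius then absorbs one factor [|w - z|]. *)
exists (Rmin (M / 2) (eps * (M * M * M) / 2)); split.
- apply Rmin_glb_lt; [lra|].
  assert (0 < M * M * M)%R by (repeat apply Rmult_lt_0_compat; lra).
  apply Rdiv_lt_0_compat; [apply Rmult_lt_0_compat|]; lra.
- intros w hw.
  assert (h1 : (Cmod (w - z) < M / 2)%R)
    by (eapply Rlt_le_trans; [exact hw|apply Rmin_l]).
  assert (h2 : (Cmod (w - z) < eps * (M * M * M) / 2)%R)
    by (eapply Rlt_le_trans; [exact hw|apply Rmin_r]).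
  pose proof (Cmod_rev_triang z (z - w)) as h3.
  rewrite (Cmod_minus_sym z w) in h3; replace (z - (z - w)) with w in h3 by ring.
  fold M in h3.
  assert (hw0 : w <> 0) by (apply Cmod_gt_0; lra).
  replace (/ w - / z - - / (z * z) * (w - z))
    with ((w - z) * (w - z) / (z * z * w)) by (field; split; assumption).
  assert (hzz : z * z * w <> 0) by (repeat apply Cmult_neq_0; assumption).
  rewrite Cmod_div by exact hzz.
  rewrite !Cmod_mult; fold M.
  pose proof (Cmod_ge_0 (w - z)) as h0.
  set (t := Cmod (w - z)) in *; set (u := Cmod w) in *.
  assert (hu : (M / 2 <= u)%R) by lra.
  assert (hMM : (0 < M * M)%R) by (apply Rmult_lt_0_compat; lra).
  assert (hd : (0 < M * M * u)%R) by (apply Rmult_lt_0_compat; lra).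
  apply (Rmult_le_reg_r (M * M * u)); [exact hd|].
  unfold Rdiv; rewrite Rmult_assoc, Rinv_l, Rmult_1_r by lra.
  replace (eps * t * (M * M * u))%R with (t * (eps * (M * M * u)))%R by ring.
  apply Rmult_le_compat_l; [exact h0|].
  assert (eps * (M * M * (M / 2)) <= eps * (M * M * u))%R
    by (apply Rmult_le_compat_l; [lra|]; apply Rmult_le_compat_l; lra).
  lra.
Qed.

Lemma cderiv_div (f g : C -> C) (z l m : C) : g z <> 0 ->
  cderiv f z l -> cderiv g z m ->
  cderiv (fun w => f w / g w) z ((l * g z - f z * m) / (g z * g z)).
Proof.
intros hg Hf Hg.
replace ((l * g z - f z * m) / (g z * g z))
  with (l * / g z + f z * (- / (g z * g z) * m)) by (field; exact hg).
apply (cderiv_mult f (fun w => / g w)); [exact Hf|].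
apply (cderiv_comp Cinv g); [apply cderiv_Cinv, hg|exact Hg].
Qed.

Lemma cderiv_pow (f : C -> C) (z l : C) (n : nat) :
  cderiv f z l -> exists m, cderiv (fun w => f w ^ n) z m.
Proof.
intros Hf; induction n as [|n [m Hm]].
- exists 0; exact (cderiv_const 1 z).
- eexists; apply (cderiv_mult f (fun w => f w ^ n)); [exact Hf|exact Hm].
Qed.

Lemma ccont_mult (f g : C -> C) (z : C) :
  ccont f z -> ccont g z -> ccont (fun w => f w * g w) z.
Proof.
intros Hf Hg eps heps.
pose proof (Cmod_ge_0 (f z)) as hf; pose proof (Cmod_ge_0 (g z)) as hg.
assert (he1 : (0 < eps / (2 * (Cmod (g z) + 1)))%R) by (apply Rdiv_lt_0_compat; lra).
assert (he2 : (0 < eps / (2 * (Cmod (f z) + 1)))%R) by (apply Rdiv_lt_0_compat; lra).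
destruct (Hf _ he1) as [d1 [hd1 H1]].
destruct (Hg (Rmin 1 (eps / (2 * (Cmod (f z) + 1))))) as [d2 [hd2 H2]];
  [apply Rmin_glb_lt; lra|].
exists (Rmin d1 d2); split; [apply Rmin_glb_lt; assumption|]; intros w hw.
specialize (H1 w (Rlt_le_trans _ _ _ hw (Rmin_l _ _))).
specialize (H2 w (Rlt_le_trans _ _ _ hw (Rmin_r _ _))).
replace (f w * g w - f z * g z)
  with ((f w - f z) * g w + f z * (g w - g z)) by ring.
eapply Rle_lt_trans; [apply Cmod_triangle|]; rewrite !Cmod_mult.
assert (h3 : (Cmod (g w - g z) < 1)%R)
  by (eapply Rlt_le_trans; [exact H2|apply Rmin_l]).
assert (h4 : (Cmod (g w - g z) < eps / (2 * (Cmod (f z) + 1)))%R)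
  by (eapply Rlt_le_trans; [exact H2|apply Rmin_r]).
pose proof (Cmod_rev_triang (g w) (g z)) as h5.
pose proof (Cmod_ge_0 (f w - f z)) as h6; pose proof (Cmod_ge_0 (g w - g z)) as h7.
assert (A1 : (Cmod (f w - f z) * Cmod (g w) < eps / 2)%R).
{ apply Rle_lt_trans with (Cmod (f w - f z) * (Cmod (g z) + 1))%R;
    [apply Rmult_le_compat_l; lra|].
  replace (eps / 2)%R with (eps / (2 * (Cmod (g z) + 1)) * (Cmod (g z) + 1))%R
    by (field; lra).
  apply Rmult_lt_compat_r; lra. }
assert (A2 : (Cmod (f z) * Cmod (g w - g z) <= eps / 2)%R).
{ apply Rle_trans with ((Cmod (f z) + 1) * Cmod (g w - g z))%R;
    [apply Rmult_le_compat_r; lra|].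
  replace (eps / 2)%R with ((Cmod (f z) + 1) * (eps / (2 * (Cmod (f z) + 1))))%R
    by (field; lra).
  apply Rmult_le_compat_l; lra. }
lra.
Qed.

Lemma ccont_const (c z : C) : ccont (fun _ => c) z.
Proof. exact (cderiv_ccont _ _ _ (cderiv_const c z)). Qed.

Lemma ccont_pow (f : C -> C) (z : C) (n : nat) :
  ccont f z -> ccont (fun w => f w ^ n) z.
Proof.
intros H; induction n as [|n IH]; [apply (ccont_const 1)|].
apply (ccont_mult f (fun w => f w ^ n)); assumption.
Qed.

(** * Goursat's theorem on rectangles *)

Definition path_cont (f : R -> C) (t : R) : Prop :=
  forall eps : R, (0 < eps)%R -> exists d : R, (0 < d)%R /\
    forall s : R, (Rabs (s - t) < d)%R -> (Cmod (f s - f t) < eps)%R.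

(** Continuity is two-sided at the endpoints as well: the paths integrated here come from functions
    that are continuous at each point of the plane region concerned, so no one-sided notion is
    introduced. *)
Definition path_cont_on (f : R -> C) (a b : R) : Prop :=
  forall t : R, (a <= t <= b)%R -> path_cont f t.

Definition CI (f : R -> C) (a b : R) : C :=
  (RInt (fun t => fst (f t)) a b, RInt (fun t => snd (f t)) a b).

Lemma im_le_Cmod (c : C) : (Rabs (Im c) <= Cmod c)%R.
Proof. eapply Rle_trans; [apply Rmax_r|apply (Rmax_Cmod c)]. Qed.

Lemma path_cont_continuous (f : R -> C) (t : R) : path_cont f t ->
  continuous (fun s => fst (f s)) t /\ continuous (fun s => snd (f s)) t.
Proof.
intros H; split; intros P [[eps heps] HP]; destruct (H eps heps) as [d [hd Hd]];
  exists (mkposreal d hd); intros s hs; apply HP; specialize (Hd s hs).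
- change (Rabs (fst (f s) - fst (f t)) < eps)%R.
  eapply Rle_lt_trans; [|exact Hd]; apply (re_le_Cmod (f s - f t)).
- change (Rabs (snd (f s) - snd (f t)) < eps)%R.
  eapply Rle_lt_trans; [|exact Hd]; apply (im_le_Cmod (f s - f t)).
Qed.

Lemma path_cont_on_ex_RInt (f : R -> C) (a b : R) : (a <= b)%R ->
  path_cont_on f a b ->
  ex_RInt (fun s => fst (f s)) a b /\ ex_RInt (fun s => snd (f s)) a b.
Proof.
intros hab H; split; apply (ex_RInt_continuous (V := R_CompleteNormedModule));
  intros t; rewrite Rmin_left, Rmax_right by exact hab; intros ht;
  apply path_cont_continuous, H, ht.
Qed.

Lemma path_cont_on_sub (f : R -> C) (a b c d : R) :
  (a <= c)%R -> (d <= b)%R -> path_cont_on f a b -> path_cont_on f c d.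
Proof. intros h1 h2 H t ht; apply H; lra. Qed.

Lemma CI_Chasles (f : R -> C) (a b c : R) : (a <= b <= c)%R ->
  path_cont_on f a c -> CI f a c = CI f a b + CI f b c.
Proof.
intros h H.
destruct (path_cont_on_ex_RInt f a b) as [A1 A2];
  [lra|apply (path_cont_on_sub f a c); [lra|lra|exact H]|].
destruct (path_cont_on_ex_RInt f b c) as [B1 B2];
  [lra|apply (path_cont_on_sub f a c); [lra|lra|exact H]|].
unfold CI, Cplus; simpl; f_equal; symmetry;
  apply (RInt_Chasles (V := R_CompleteNormedModule)); assumption.
Qed.

Lemma CI_ext (f g : R -> C) (a b : R) : (a <= b)%R ->
  (forall t, (a < t < b)%R -> f t = g t) -> CI f a b = CI g a b.
Proof.
intros hab H; unfold CI; f_equal; apply RInt_ext; intros t;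
  rewrite Rmin_left, Rmax_right by exact hab; intros ht; rewrite H; auto.
Qed.

Lemma CI_plus (f g : R -> C) (a b : R) : (a <= b)%R ->
  path_cont_on f a b -> path_cont_on g a b ->
  CI (fun t => f t + g t) a b = CI f a b + CI g a b.
Proof.
intros hab Hf Hg.
destruct (path_cont_on_ex_RInt f a b hab Hf) as [A1 A2].
destruct (path_cont_on_ex_RInt g a b hab Hg) as [B1 B2].
unfold CI, Cplus; simpl; f_equal; apply (RInt_plus (V := R_CompleteNormedModule));
  assumption.
Qed.

Lemma CI_scal (c : C) (f : R -> C) (a b : R) : (a <= b)%R ->
  path_cont_on f a b -> CI (fun t => c * f t) a b = c * CI f a b.
Proof.
intros hab Hf.
destruct (path_cont_on_ex_RInt f a b hab Hf) as [A1 A2].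
unfold CI, Cmult; simpl; f_equal; apply is_RInt_unique.
- apply (is_RInt_minus (V := R_NormedModule));
    apply (is_RInt_scal (V := R_NormedModule)),
      (RInt_correct (V := R_CompleteNormedModule)); assumption.
- apply (is_RInt_plus (V := R_NormedModule));
    apply (is_RInt_scal (V := R_NormedModule)),
      (RInt_correct (V := R_CompleteNormedModule)); assumption.
Qed.

Lemma CI_const (c : C) (a b : R) : CI (fun _ => c) a b = RtoC (b - a) * c.
Proof.
unfold CI; rewrite !RInt_const; unfold Cmult, RtoC; simpl.
unfold scal; simpl; unfold mult; simpl; f_equal; ring.
Qed.

Lemma CI_conj (f : R -> C) (a b : R) : (a <= b)%R -> path_cont_on f a b ->
  CI (fun t => Cconj (f t)) a b = Cconj (CI f a b).
Proof.
intros hab Hf.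
destruct (path_cont_on_ex_RInt f a b hab Hf) as [A1 A2].
unfold CI, Cconj; simpl; f_equal.
apply (RInt_opp (V := R_CompleteNormedModule)); exact A2.
Qed.

(** Read as one integral with values in [C] over [R], the pair obeys the norm inequality for
    vector-valued integrals; bounding the two components separately would cost a factor [sqrt 2]. *)
Lemma CI_bound (f : R -> C) (a b M : R) : (a <= b)%R -> path_cont_on f a b ->
  (forall t, (a <= t <= b)%R -> (Cmod (f t) <= M)%R) ->
  (Cmod (CI f a b) <= (b - a) * M)%R.
Proof.
intros hab Hf HM.
destruct (path_cont_on_ex_RInt f a b hab Hf) as [A1 A2].
rewrite Cmod_norm.
apply (norm_RInt_le (V := C_R_NormedModule) f (fun _ => M) a b); [exact hab| | |].
- intros t ht; change (norm (f t)) with (@norm R_AbsRing C_R_NormedModule (f t)).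
  rewrite <- Cmod_norm; apply HM, ht.
- apply (is_RInt_fct_extend_pair (U := R_NormedModule) (V := R_NormedModule));
    apply (RInt_correct (V := R_CompleteNormedModule)); assumption.
- apply (is_RInt_const (V := R_NormedModule)).
Qed.

Lemma path_cont_plus (f g : R -> C) (t : R) :
  path_cont f t -> path_cont g t -> path_cont (fun s => f s + g s) t.
Proof.
intros Hf Hg eps heps.
destruct (Hf (eps / 2)%R ltac:(lra)) as [d1 [hd1 H1]].
destruct (Hg (eps / 2)%R ltac:(lra)) as [d2 [hd2 H2]].
exists (Rmin d1 d2); split; [apply Rmin_glb_lt; assumption|]; intros s hs.
specialize (H1 s (Rlt_le_trans _ _ _ hs (Rmin_l _ _))).
specialize (H2 s (Rlt_le_trans _ _ _ hs (Rmin_r _ _))).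
replace (f s + g s - (f t + g t)) with ((f s - f t) + (g s - g t)) by ring.
eapply Rle_lt_trans; [apply Cmod_triangle|]; lra.
Qed.

Lemma path_cont_const (c : C) (t : R) : path_cont (fun _ => c) t.
Proof.
intros eps heps; exists 1%R; split; [lra|]; intros s _.
rewrite Cmod_minus_self; exact heps.
Qed.

Lemma path_cont_comp (F : C -> C) (f : R -> C) (t : R) :
  ccont F (f t) -> path_cont f t -> path_cont (fun s => F (f s)) t.
Proof.
intros HF Hf eps heps.
destruct (HF eps heps) as [d [hd Hd]]; destruct (Hf d hd) as [e [he He]].
exists e; split; [exact he|]; intros s hs; apply Hd, He, hs.
Qed.

Lemma path_cont_minus (f g : R -> C) (t : R) :
  path_cont f t -> path_cont g t -> path_cont (fun s => f s - g s) t.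
Proof.
intros Hf Hg; apply path_cont_plus; [exact Hf|].
apply (path_cont_comp Copp g); [|exact Hg].
intros eps heps; exists eps; split; [exact heps|]; intros w hw.
replace (- w - - g t) with (g t - w) by ring; rewrite Cmod_minus_sym; exact hw.
Qed.

Lemma Cmod_pair_fst (x y c : R) : Cmod ((x, c) - (y, c)) = Rabs (x - y).
Proof.
replace ((x, c) - (y, c)) with (RtoC (x - y)); [apply Cmod_R|].
unfold RtoC, Cminus, Cplus, Copp; simpl; f_equal; ring.
Qed.

Lemma Cmod_pair_snd (x y c : R) : Cmod ((c, x) - (c, y)) = Rabs (x - y).
Proof.
replace ((c, x) - (c, y)) with (Ci * RtoC (x - y));
  [rewrite Cmod_mult, Cmod_Ci, Cmod_R; ring|].
unfold RtoC, Cminus, Cplus, Copp, Cmult; simpl; f_equal; ring.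
Qed.

Lemma path_cont_horizontal (F : C -> C) (s t : R) :
  ccont F (s, t) -> path_cont (fun x => F (x, t)) s.
Proof.
intros H; apply (path_cont_comp F (fun x => (x, t))); [exact H|].
intros eps heps; exists eps; split; [exact heps|]; intros x hx.
rewrite Cmod_pair_fst; exact hx.
Qed.

Lemma path_cont_vertical (F : C -> C) (s t : R) :
  ccont F (s, t) -> path_cont (fun x => F (s, x)) t.
Proof.
intros H; apply (path_cont_comp F (fun x => (s, x))); [exact H|].
intros eps heps; exists eps; split; [exact heps|]; intros x hx.
rewrite Cmod_pair_snd; exact hx.
Qed.

(** * Boundary integrals over rectangles and bisection *)

Definition rect_cont (F : C -> C) (a b c d : R) : Prop :=
  forall s t : R, (a <= s <= b)%R -> (c <= t <= d)%R -> ccont F (s, t).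

(* Minus the contour integral of [F] along the boundary of [a,b] x [c,d]. *)
Definition boundary_int (F : C -> C) (a b c d : R) : C :=
  CI (fun s => F (s, d) - F (s, c)) a b
  - Ci * CI (fun t => F (b, t) - F (a, t)) c d.

Lemma rect_cont_sub (F : C -> C) (a b c d a' b' c' d' : R) :
  (a <= a')%R -> (b' <= b)%R -> (c <= c')%R -> (d' <= d)%R ->
  rect_cont F a b c d -> rect_cont F a' b' c' d'.
Proof. intros h1 h2 h3 h4 H s t hs ht; apply H; lra. Qed.

Lemma rect_cont_horizontal (F : C -> C) (a b c d u v : R) :
  (c <= u <= d)%R -> (c <= v <= d)%R ->
  rect_cont F a b c d -> path_cont_on (fun s => F (s, v) - F (s, u)) a b.
Proof.
intros hu hv H s hs; apply path_cont_minus; apply path_cont_horizontal, H; lra.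
Qed.

Lemma rect_cont_vertical (F : C -> C) (a b c d u v : R) :
  (a <= u <= b)%R -> (a <= v <= b)%R ->
  rect_cont F a b c d -> path_cont_on (fun t => F (v, t) - F (u, t)) c d.
Proof.
intros hu hv H s hs; apply path_cont_minus; apply path_cont_vertical, H; lra.
Qed.

Lemma boundary_int_split_fst (F : C -> C) (a m b c d : R) :
  (a <= m <= b)%R -> (c <= d)%R -> rect_cont F a b c d ->
  boundary_int F a b c d = boundary_int F a m c d + boundary_int F m b c d.
Proof.
intros hm hcd H; unfold boundary_int.
rewrite (CI_Chasles (fun s => F (s, d) - F (s, c)) a m b hm)
  by (apply (rect_cont_horizontal F a b c d); [lra|lra|exact H]).
assert (E : CI (fun t => F (b, t) - F (a, t)) c d
  = CI (fun t => F (m, t) - F (a, t)) c d + CI (fun t => F (b, t) - F (m, t)) c d).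
{ rewrite <- CI_plus;
    [|exact hcd|apply (rect_cont_vertical F a b c d); [lra|lra|exact H]
     |apply (rect_cont_vertical F a b c d); [lra|lra|exact H]].
  apply CI_ext; [exact hcd|]; intros t _; ring. }
rewrite E; ring.
Qed.

Lemma boundary_int_split_snd (F : C -> C) (a b c m d : R) :
  (c <= m <= d)%R -> (a <= b)%R -> rect_cont F a b c d ->
  boundary_int F a b c d = boundary_int F a b c m + boundary_int F a b m d.
Proof.
intros hm hab H; unfold boundary_int.
rewrite (CI_Chasles (fun t => F (b, t) - F (a, t)) c m d hm)
  by (apply (rect_cont_vertical F a b c d); [lra|lra|exact H]).
assert (E : CI (fun s => F (s, d) - F (s, c)) a b
  = CI (fun s => F (s, m) - F (s, c)) a b + CI (fun s => F (s, d) - F (s, m)) a b).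
{ rewrite <- CI_plus;
    [|exact hab|apply (rect_cont_horizontal F a b c d); [lra|lra|exact H]
     |apply (rect_cont_horizontal F a b c d); [lra|lra|exact H]].
  apply CI_ext; [exact hab|]; intros t _; ring. }
rewrite E; ring.
Qed.

(* The boundary integral of an affine function vanishes, so only the remainder
   of the first-order expansion contributes. *)
Lemma boundary_int_small (F : C -> C) (a b c d eps : R) (z l : C) :
  (a <= b)%R -> (c <= d)%R -> rect_cont F a b c d ->
  (forall s t, (a <= s <= b)%R -> (c <= t <= d)%R ->
     (Cmod (F (s, t) - F z - l * ((s, t) - z))
      <= eps * ((b - a) + (d - c)))%R) ->
  (Cmod (boundary_int F a b c d) <= 2 * eps * ((b - a) + (d - c)) ^ 2)%R.
Proof.
intros hab hcd HF H; unfold boundary_int.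
set (E := fun w : C => F w - F z - l * (w - z)).
set (S := ((b - a) + (d - c))%R) in *.
(* The linear part contributes [l * Ci * (d - c) * (b - a)] on the horizontal sides; [Ci] times its
   contribution on the vertical sides in [A2] is the same number, so the two cancel in the
   difference. *)
assert (A1 : CI (fun s => F (s, d) - F (s, c)) a b
  = CI (fun s => F (s, d) - F (s, c) - l * Ci * RtoC (d - c)) a b
    + RtoC (b - a) * (l * Ci * RtoC (d - c))).
{ rewrite <- CI_const, <- CI_plus; [apply CI_ext; [exact hab|intros; ring]|exact hab| |].
  - intros s hs; apply path_cont_minus; [|apply path_cont_const].
    apply (rect_cont_horizontal F a b c d); auto; lra.
  - intros s hs; apply path_cont_const. }
assert (A2 : CI (fun t => F (b, t) - F (a, t)) c d
  = CI (fun t => F (b, t) - F (a, t) - l * RtoC (b - a)) c d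
    + RtoC (d - c) * (l * RtoC (b - a))).
{ rewrite <- CI_const, <- CI_plus; [apply CI_ext; [exact hcd|intros; ring]|exact hcd| |].
  - intros s hs; apply path_cont_minus; [|apply path_cont_const].
    apply (rect_cont_vertical F a b c d); auto; lra.
  - intros s hs; apply path_cont_const. }
rewrite A1, A2.
match goal with |- (Cmod (?X + ?u - Ci * (?Y + ?v)) <= _)%R =>
  replace (X + u - Ci * (Y + v)) with (X - Ci * Y) by ring end.
assert (B1 : (Cmod (CI (fun s => F (s, d) - F (s, c) - l * Ci * RtoC (d - c))%C a b)
   <= (b - a) * (2 * (eps * S)))%R).
{ apply CI_bound; [exact hab| |].
  - intros s hs; apply path_cont_minus; [|apply path_cont_const].
    apply (rect_cont_horizontal F a b c d); auto; lra.
  - intros s hs.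
    replace (F (s, d) - F (s, c) - l * Ci * RtoC (d - c))
      with (E (s, d) - E (s, c)).
    + eapply Rle_trans; [apply Cmod_triangle|]; rewrite Cmod_opp.
      pose proof (H s d hs ltac:(lra)); pose proof (H s c hs ltac:(lra)).
      unfold E; lra.
    + unfold E.
      replace ((s, d) : C) with ((s, c) + Ci * RtoC (d - c))
        by (unfold Cplus, Cmult, Ci, RtoC; simpl; f_equal; ring).
      ring. }
assert (B2 : (Cmod (CI (fun t => F (b, t) - F (a, t) - l * RtoC (b - a))%C c d)
   <= (d - c) * (2 * (eps * S)))%R).
{ apply CI_bound; [exact hcd| |].
  - intros s hs; apply path_cont_minus; [|apply path_cont_const].
    apply (rect_cont_vertical F a b c d); auto; lra.
  - intros s hs.
    replace (F (b, s) - F (a, s) - l * RtoC (b - a))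
      with (E (b, s) - E (a, s)).
    + eapply Rle_trans; [apply Cmod_triangle|]; rewrite Cmod_opp.
      pose proof (H b s ltac:(lra) hs); pose proof (H a s ltac:(lra) hs).
      unfold E; lra.
    + unfold E.
      replace ((b, s) : C) with ((a, s) + RtoC (b - a))
        by (unfold Cplus, Cmult, Ci, RtoC; simpl; f_equal; ring).
      ring. }
eapply Rle_trans; [apply Cmod_triangle|].
rewrite Cmod_opp, Cmod_mult, Cmod_Ci, Rmult_1_l.
eapply Rle_trans; [apply Rplus_le_compat; [exact B1|exact B2]|].
right; unfold S; ring.
Qed.

(** Halving both sides divides the bound [eps * (L + M)^2] by four, while the boundary integral is
    the sum over four quarters. If every quarter respected its bound, so would the whole. The
    conclusion keeps only the range of the new corner, which is what nesting needs. *)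
Lemma boundary_int_quarter (F : C -> C) (a c L M eps : R) :
  (0 <= L)%R -> (0 <= M)%R -> rect_cont F a (a + L) c (c + M) ->
  (eps * (L + M) ^ 2 < Cmod (boundary_int F a (a + L) c (c + M)))%R ->
  exists a' c' : R, (a <= a' <= a + L / 2)%R /\ (c <= c' <= c + M / 2)%R /\
    (eps * (L / 2 + M / 2) ^ 2
     < Cmod (boundary_int F a' (a' + L / 2) c' (c' + M / 2)))%R.
Proof.
intros hL hM HF H; apply NNPP; intros N.
assert (Q : forall a' c', (a <= a' <= a + L / 2)%R -> (c <= c' <= c + M / 2)%R ->
  (Cmod (boundary_int F a' (a' + L / 2) c' (c' + M / 2))
   <= eps * (L / 2 + M / 2) ^ 2)%R).
{ intros a' c' h1 h2; apply Rnot_lt_le; intros h3; apply N; exists a', c'; auto. }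
apply (Rlt_not_le _ _ H).
rewrite (boundary_int_split_fst F a (a + L / 2) (a + L)) by (try lra; exact HF).
rewrite (boundary_int_split_snd F a (a + L / 2) c (c + M / 2) (c + M))
  by (try lra; apply (rect_cont_sub F a (a + L) c (c + M)); try lra; exact HF).
rewrite (boundary_int_split_snd F (a + L / 2) (a + L) c (c + M / 2) (c + M))
  by (try lra; apply (rect_cont_sub F a (a + L) c (c + M)); try lra; exact HF).
eapply Rle_trans; [apply Cmod_triangle|].
eapply Rle_trans; [apply Rplus_le_compat; apply Cmod_triangle|].
assert (Q1 := Q a c ltac:(lra) ltac:(lra)).
assert (Q2 := Q a (c + M / 2)%R ltac:(lra) ltac:(lra)).
assert (Q3 := Q (a + L / 2)%R c ltac:(lra) ltac:(lra)).
assert (Q4 := Q (a + L / 2)%R (c + M / 2)%R ltac:(lra) ltac:(lra)).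
replace (a + L / 2 + L / 2)%R with (a + L)%R in * by field.
replace (c + M / 2 + M / 2)%R with (c + M)%R in * by field.
replace (eps * (L + M) ^ 2)%R with (4 * (eps * (L / 2 + M / 2) ^ 2))%R by field.
lra.
Qed.

(** The supremum of the left endpoints works, because nesting puts every left endpoint below every
    right endpoint. *)
Lemma nested_point (u l : nat -> R) :
  (forall n, (u n <= u (S n))%R) ->
  (forall n, (u (S n) + l (S n) <= u n + l n)%R) -> (forall n, (0 <= l n)%R) ->
  exists x, forall n, (u n <= x <= u n + l n)%R.
Proof.
intros H1 H2 hl.
assert (M1 : forall n k, (u n <= u (n + k)%nat)%R).
{ intros n k; induction k as [|k IH]; [rewrite Nat.add_0_r; lra|].
  rewrite Nat.add_succ_r; specialize (H1 (n + k)%nat); lra. }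
assert (M2 : forall n k, (u (n + k)%nat + l (n + k)%nat <= u n + l n)%R).
{ intros n k; induction k as [|k IH]; [rewrite Nat.add_0_r; lra|].
  rewrite Nat.add_succ_r; specialize (H2 (n + k)%nat); lra. }
assert (B : forall n k, (u k <= u n + l n)%R).
{ intros n k; destruct (Nat.le_ge_cases n k) as [h|h].
  - replace k with (n + (k - n))%nat by lia.
    specialize (M2 n (k - n)%nat); specialize (hl (n + (k - n))%nat); lra.
  - specialize (M1 k (n - k)%nat); replace (k + (n - k))%nat with n in M1 by lia.
    specialize (hl n); lra. }
destruct (completeness (fun y => exists n, y = u n)) as [x [Hx1 Hx2]].
- exists (u O + l O)%R; intros y [k ->]; apply B.
- exists (u O), O; reflexivity.
- exists x; intros n; split.
  + apply Hx1; exists n; reflexivity.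
  + apply Hx2; intros y [k ->]; apply B.
Qed.

Lemma Cmod_le_sum (x y u v : R) :
  (Cmod ((x, y) - (u, v)) <= Rabs (x - u) + Rabs (y - v))%R.
Proof.
eapply Rle_trans; [apply (Cmod_triang_via _ (u, y))|].
rewrite Cmod_pair_fst, Cmod_pair_snd; lra.
Qed.

Lemma Rle_0_of_le_mul (x K : R) : (0 <= K)%R ->
  (forall eps, (0 < eps)%R -> (x <= eps * K)%R) -> (x <= 0)%R.
Proof.
intros hK H; apply Rnot_lt_le; intros hx.
specialize (H (x / (2 * (K + 1)))%R ltac:(apply Rdiv_lt_0_compat; lra)).
assert (E : (x / (2 * (K + 1)) * K < x)%R).
{ apply (Rmult_lt_reg_r (2 * (K + 1))); [lra|].
  replace (x / (2 * (K + 1)) * K * (2 * (K + 1)))%R with (x * K)%R by (field; lra).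
  nra. }
lra.
Qed.

(** Bad sub-rectangles are only known to exist. Carrying the invariant [P n] in a subtype makes the
    choice of a successor a total function, which can then be iterated. *)
Lemma dependent_choice {T : Type} (P : nat -> T -> Prop)
  (Q : nat -> T -> T -> Prop) (x0 : T) : P O x0 ->
  (forall n x, P n x -> exists y, Q n x y /\ P (S n) y) ->
  exists p : nat -> T, (forall n, P n (p n)) /\ forall n, Q n (p n) (p (S n)).
Proof.
intros H0 HS.
set (next := fun n (x : {x | P n x}) =>
  let (y, Hy) := constructive_indefinite_description _ (HS n _ (proj2_sig x)) in
  exist (P (S n)) y (proj2 Hy)).
set (p := fix p n : {x | P n x} :=
  match n with O => exist (P O) x0 H0 | S m => next m (p m) end).
exists (fun n => proj1_sig (p n)); split; [intros n; apply proj2_sig|].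
intros n; simpl; unfold next.
destruct constructive_indefinite_description as [y Hy]; exact (proj1 Hy).
Qed.

(** If the boundary integral exceeded [eps * (L + M)^2], bisection would give nested rectangles
    exceeding the corresponding bound at every scale. Near their common point the first-order
    expansion of [F] forces the opposite inequality. As [eps] is arbitrary, the integral
    vanishes. *)
Lemma goursat (F : C -> C) (a c L M : R) : (0 <= L)%R -> (0 <= M)%R ->
  (forall s t, (a <= s <= a + L)%R -> (c <= t <= c + M)%R ->
     exists l, cderiv F (s, t) l) ->
  boundary_int F a (a + L) c (c + M) = 0.
Proof.
intros hL hM HF.
assert (HC : rect_cont F a (a + L) c (c + M)).
{ intros s t hs ht; destruct (HF s t hs ht) as [l Hl]; exact (cderiv_ccont _ _ _ Hl). }
apply Cmod_eq_0, Rle_antisym; [|apply Cmod_ge_0].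
apply (Rle_0_of_le_mul _ ((L + M) ^ 2)); [apply pow2_ge_0|].
intros eps heps; apply Rnot_lt_le; intros Hbad.
set (inside := fun n (p : R * R) =>
  (a <= fst p)%R /\ (fst p + L / 2 ^ n <= a + L)%R /\
  (c <= snd p)%R /\ (snd p + M / 2 ^ n <= c + M)%R).
set (bad := fun n (p : R * R) => inside n p /\
  (eps * (L / 2 ^ n + M / 2 ^ n) ^ 2
   < Cmod (boundary_int F (fst p) (fst p + L / 2 ^ n) (snd p) (snd p + M / 2 ^ n)))%R).
assert (pos2 : forall n, (0 < 2 ^ n)%R) by (intros n; apply pow_lt; lra).
assert (hLn : forall n, (0 <= L / 2 ^ n)%R).
{ intros n; apply Rmult_le_pos; [lra|]; left; apply Rinv_0_lt_compat, pos2. }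
assert (hMn : forall n, (0 <= M / 2 ^ n)%R).
{ intros n; apply Rmult_le_pos; [lra|]; left; apply Rinv_0_lt_compat, pos2. }
assert (halfL : forall n, (L / 2 ^ S n = L / 2 ^ n / 2)%R).
{ intros n; simpl; field; specialize (pos2 n); lra. }
assert (halfM : forall n, (M / 2 ^ S n = M / 2 ^ n / 2)%R).
{ intros n; simpl; field; specialize (pos2 n); lra. }
assert (step : forall n p, bad n p -> exists q,
  (fst p <= fst q <= fst p + L / 2 ^ S n)%R /\
  (snd p <= snd q <= snd p + M / 2 ^ S n)%R /\ bad (S n) q).
{ intros n p [[i1 [i2 [i3 i4]]] B].
  destruct (boundary_int_quarter F (fst p) (snd p) (L / 2 ^ n) (M / 2 ^ n) eps
              (hLn n) (hMn n)) as [a' [c' [h1 [h2 h3]]]]; [|exact B|].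
  - apply (rect_cont_sub F a (a + L) c (c + M)); try lra; exact HC.
  - exists (a', c'); unfold bad, inside; rewrite halfL, halfM; simpl.
    repeat split; lra. }
destruct (dependent_choice bad (fun n p q =>
  (fst p <= fst q <= fst p + L / 2 ^ S n)%R /\
  (snd p <= snd q <= snd p + M / 2 ^ S n)%R) (a, c)) as [p [Hp Hstep]].
- unfold bad, inside; simpl; unfold Rdiv; rewrite !Rinv_1, !Rmult_1_r.
  repeat split; try lra; exact Hbad.
- intros n q Hq; destruct (step n q Hq) as [q' [h1 [h2 h3]]]; exists q'; auto.
- assert (X : exists x, forall n,
    (fst (p n) <= x <= fst (p n) + L / 2 ^ n)%R).
  { apply nested_point; [intros n; apply Hstep| |exact hLn].
    intros n; destruct (Hstep n) as [h _]; rewrite halfL in *; lra. }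
  assert (Y : exists y, forall n,
    (snd (p n) <= y <= snd (p n) + M / 2 ^ n)%R).
  { apply nested_point; [intros n; apply Hstep| |exact hMn].
    intros n; destruct (Hstep n) as [_ h]; rewrite halfM in *; lra. }
  destruct X as [x Hx], Y as [y Hy].
  destruct (HF x y) as [l Hl].
  { destruct (Hp O) as [[i1 [i2 _]] _]; specialize (Hx O); lra. }
  { destruct (Hp O) as [[_ [_ [i1 i2]]] _]; specialize (Hy O); lra. }
  (* [boundary_int_small] doubles the constant of the expansion, hence [eps / 2]. *)
  destruct (Hl (eps / 2)%R ltac:(lra)) as [r [hr Hr]].
  (* The scale [n] is chosen so that the half-perimeter [(L + M) / 2 ^ n], which bounds the distance
     to the common point, is below [r]; the [+ 1] covers [L = M = 0]. *)
  destruct (pow_lt_1_zero (/ 2) ltac:(rewrite Rabs_pos_eq; lra) (r / (L + M + 1)))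
    as [n Hn]; [apply Rdiv_lt_0_compat; lra|].
  specialize (Hn n (le_n n)).
  rewrite Rabs_pos_eq in Hn by (apply pow_le; lra).
  assert (small : (L / 2 ^ n + M / 2 ^ n < r)%R).
  { replace (L / 2 ^ n + M / 2 ^ n)%R with ((L + M) * (/ 2) ^ n)%R
      by (rewrite pow_inv; field; specialize (pos2 n); lra).
    apply Rle_lt_trans with ((L + M + 1) * (/ 2) ^ n)%R;
      [apply Rmult_le_compat_r; [apply pow_le|]; lra|].
    apply (Rmult_lt_compat_l (L + M + 1)) in Hn; [|lra].
    replace ((L + M + 1) * (r / (L + M + 1)))%R with r in Hn by (field; lra).
    exact Hn. }
  destruct (Hp n) as [[i1 [i2 [i3 i4]]] B].
  apply (Rlt_not_le _ _ B).
  specialize (hLn n); specialize (hMn n); specialize (Hx n); specialize (Hy n).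
  assert (E := boundary_int_small F (fst (p n)) (fst (p n) + L / 2 ^ n)
    (snd (p n)) (snd (p n) + M / 2 ^ n) (eps / 2) (x, y) l).
  replace (fst (p n) + L / 2 ^ n - fst (p n)
           + (snd (p n) + M / 2 ^ n - snd (p n)))%R
    with (L / 2 ^ n + M / 2 ^ n)%R in E by ring.
  replace (2 * (eps / 2))%R with eps in E by field.
  apply E; [lra|lra| |].
  + apply (rect_cont_sub F a (a + L) c (c + M)); try lra; exact HC.
  + intros s t hs ht.
    assert (D : (Cmod ((s, t) - (x, y)) <= L / 2 ^ n + M / 2 ^ n)%R).
    { eapply Rle_trans; [apply Cmod_le_sum|].
      apply Rplus_le_compat; apply Rabs_le; lra. }
    eapply Rle_trans; [apply Hr; lra|].
    apply Rmult_le_compat_l; lra.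
Qed.

(** * Circle means *)

Definition circ (r t : R) : C := ((r * cos t)%R, (r * sin t)%R).

Definition cexp (w : C) : C := circ (exp (fst w)) (snd w).

Lemma derivable_pt_lim_expansion (f : R -> R) (l eps : R) :
  derivable_pt_lim f 0 l -> (0 < eps)%R ->
  exists d : R, (0 < d)%R /\ forall h : R, (Rabs h < d)%R ->
    (Rabs (f h - f 0 - l * h) <= eps * Rabs h)%R.
Proof.
intros H heps; destruct (H eps heps) as [[d hd] Hd]; exists d; split; [exact hd|].
intros h hh; destruct (Req_dec h 0) as [->|h0].
- replace (f 0 - f 0 - l * 0)%R with 0%R by ring; rewrite Rabs_R0; lra.
- specialize (Hd h h0 hh); rewrite Rplus_0_l in Hd.
  replace (f h - f 0 - l * h)%R with (((f h - f 0) / h - l) * h)%R by (field; exact h0).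
  rewrite Rabs_mult; apply Rmult_le_compat_r; [apply Rabs_pos|lra].
Qed.

Lemma cexp_plus (z w : C) : cexp (z + w) = cexp z * cexp w.
Proof.
unfold cexp, circ, Cmult; simpl; rewrite exp_plus, cos_plus, sin_plus.
f_equal; ring.
Qed.

Lemma cexp_0 : cexp 0 = 1.
Proof. unfold cexp, circ; simpl; rewrite exp_0, cos_0, sin_0; unfold RtoC; f_equal; ring. Qed.

Lemma cderiv_cexp_0 : cderiv cexp 0 1.
Proof.
intros eps0 heps0.
(* The remainder has real part [(exp x - 1 - x) + exp x * (cos y - 1)] and imaginary part
   [exp x * (sin y - y) + (exp x - 1) * y]. With [|exp x| <= 2] the four terms cost
   [1 + 2 + 2 + 1 = 6] times [eps * |w|]. The cap [eps <= 1] and the radius [eps / 2] below give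
   [|exp x - 1| <= eps] and that bound. *)
set (eps := Rmin 1 (eps0 / 6)).
assert (heps : (0 < eps)%R) by (apply Rmin_glb_lt; lra).
assert (heps1 : (eps <= 1)%R) by apply Rmin_l.
assert (heps2 : (eps <= eps0 / 6)%R) by apply Rmin_r.
destruct (derivable_pt_lim_expansion exp 1 eps derivable_pt_lim_exp_0 heps)
  as [d1 [hd1 H1]].
destruct (derivable_pt_lim_expansion sin 1 eps derivable_pt_lim_sin_0 heps)
  as [d2 [hd2 H2]].
assert (hc : derivable_pt_lim cos 0 0).
{ pose proof (derivable_pt_lim_cos 0) as h; rewrite sin_0, Ropp_0 in h; exact h. }
destruct (derivable_pt_lim_expansion cos 0 eps hc heps) as [d3 [hd3 H3]].
exists (Rmin (Rmin d1 d2) (Rmin d3 (eps / 2))); split.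
{ repeat apply Rmin_glb_lt; lra. }
intros [x y] hw.
replace ((x, y) - RtoC 0) with ((x, y) : C) in *
  by (unfold RtoC, Cminus, Cplus, Copp; simpl; f_equal; ring).
rewrite cexp_0.
set (m := Cmod (x, y)) in *.
assert (hx : (Rabs x <= m)%R) by apply (re_le_Cmod (x, y)).
assert (hy : (Rabs y <= m)%R) by apply (im_le_Cmod (x, y)).
pose proof (Rmin_l (Rmin d1 d2) (Rmin d3 (eps / 2))) as m1.
pose proof (Rmin_r (Rmin d1 d2) (Rmin d3 (eps / 2))) as m2.
pose proof (Rmin_l d1 d2) as m3; pose proof (Rmin_r d1 d2) as m4.
pose proof (Rmin_l d3 (eps / 2)) as m5; pose proof (Rmin_r d3 (eps / 2)) as m6.
specialize (H1 x ltac:(lra)); specialize (H2 y ltac:(lra)); specialize (H3 y ltac:(lra)).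
rewrite exp_0 in H1; rewrite sin_0 in H2; rewrite cos_0 in H3.
replace (sin y - 0 - 1 * y)%R with (sin y - y)%R in H2 by ring.
replace (cos y - 1 - 0 * y)%R with (cos y - 1)%R in H3 by ring.
replace (exp x - 1 - 1 * x)%R with (exp x - 1 - x)%R in H1 by ring.
pose proof (Rabs_pos x) as px; pose proof (Rabs_pos y) as py.
assert (E1 : (Rabs (exp x - 1) <= eps)%R).
{ replace (exp x - 1)%R with ((exp x - 1 - x) + x)%R by ring.
  eapply Rle_trans; [apply Rabs_triang|]. nra. }
assert (E2 : (Rabs (exp x) <= 2)%R).
{ replace (exp x) with ((exp x - 1) + 1)%R by ring.
  eapply Rle_trans; [apply Rabs_triang|]; rewrite Rabs_R1; lra. }
pose proof (Rabs_pos (exp x)) as E3.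
replace (cexp (x, y) - 1 - 1 * (x, y))
  with (((exp x - 1 - x)%R + (exp x * (cos y - 1))%R : R,
         exp x * (sin y - y) + (exp x - 1) * y)%R : C)
  by (unfold cexp, circ, RtoC, Cminus, Cplus, Copp, Cmult; simpl; f_equal; ring).
replace ((_, _) : C) with
  (((exp x - 1 - x)%R + (exp x * (cos y - 1))%R : R, exp x * (sin y - y) + (exp x - 1) * y)%R - (0, 0)%R)
  by (unfold Cminus, Cplus, Copp; simpl; f_equal; ring).
eapply Rle_trans; [apply Cmod_le_sum|]; rewrite !Rminus_0_r.
eapply Rle_trans; [apply Rplus_le_compat; apply Rabs_triang|].
rewrite !Rabs_mult.
assert (F1 : (Rabs (exp x) * Rabs (cos y - 1) <= 2 * (eps * m))%R)
  by (apply Rmult_le_compat; try apply Rabs_pos; nra).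
assert (F2 : (Rabs (exp x) * Rabs (sin y - y) <= 2 * (eps * m))%R)
  by (apply Rmult_le_compat; try apply Rabs_pos; nra).
assert (F3 : (Rabs (exp x - 1) * Rabs y <= eps * m)%R)
  by (apply Rmult_le_compat; try apply Rabs_pos; lra).
assert (F4 : (eps * Rabs x <= eps * m)%R) by (apply Rmult_le_compat_l; lra).
assert (F5 : (eps * m <= eps0 / 6 * m)%R) by (apply Rmult_le_compat_r; lra).
lra.
Qed.

Lemma cderiv_cexp (z : C) : cderiv cexp z (cexp z).
Proof.
apply (cderiv_ext_loc (fun w => cexp z * cexp (w + - z)) _ _ _ 1 Rlt_0_1).
- intros w _; rewrite <- cexp_plus; f_equal; ring.
- apply (cderiv_eq _ _ (cexp z * (1 * (1 + 0)))); [|ring].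
  apply cderiv_scal, (cderiv_comp cexp (fun w => w + - z)).
  + replace (z + - z) with (RtoC 0) by ring; apply cderiv_cexp_0.
  + apply cderiv_plus; [apply cderiv_id|apply cderiv_const].
Qed.

Lemma Cmod_circ (r t : R) : (0 <= r)%R -> Cmod (circ r t) = r.
Proof.
intros hr; unfold Cmod, circ; simpl.
pose proof (sin2_cos2 t) as H; unfold Rsqr in H.
replace (r * cos t * (r * cos t * 1) + r * sin t * (r * sin t * 1))%R
  with (r * r)%R; [apply sqrt_square, hr|].
replace (r * cos t * (r * cos t * 1) + r * sin t * (r * sin t * 1))%R
  with (r * r * (sin t * sin t + cos t * cos t))%R by ring.
rewrite H; ring.
Qed.

Lemma circ_ccont (w : C) : ccont (fun w => circ (fst w) (snd w)) w.
Proof.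
apply (ccont_ext_loc (fun w => RtoC (fst w) * cexp (Ci * RtoC (snd w))) _ _ 1 Rlt_0_1).
- intros u _; unfold cexp, circ, Cmult, RtoC, Ci; simpl.
  replace (0 * snd u - 1 * 0)%R with 0%R by ring; rewrite exp_0.
  replace (0 * 0 + 1 * snd u)%R with (snd u) by ring.
  f_equal; ring.
- apply (ccont_mult (fun w => RtoC (fst w)) (fun w => cexp (Ci * RtoC (snd w)))).
  + intros eps heps; exists eps; split; [exact heps|]; intros u hu.
    eapply Rle_lt_trans; [|exact hu].
    rewrite <- RtoC_minus, Cmod_R; apply (re_le_Cmod (u - w)).
  + intros eps heps.
    destruct (cderiv_ccont _ _ _ (cderiv_cexp (Ci * RtoC (snd w))) eps heps)
      as [d [hd Hd]].
    exists d; split; [exact hd|]; intros u hu; apply Hd.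
    eapply Rle_lt_trans; [|exact hu].
    replace (Ci * RtoC (snd u) - Ci * RtoC (snd w))
      with (Ci * RtoC (snd u - snd w)) by (rewrite RtoC_minus; ring).
    rewrite Cmod_mult, Cmod_Ci, Cmod_R, Rmult_1_l; apply (im_le_Cmod (u - w)).
Qed.

Lemma circ_path_cont (k : C -> C) (r t : R) :
  ccont k (circ r t) -> path_cont (fun s => k (circ r s)) t.
Proof.
intros H; apply (path_cont_comp k (fun s => circ r s)); [exact H|].
apply (path_cont_vertical (fun w => circ (fst w) (snd w)) r t), circ_ccont.
Qed.

(** Integration is against the angle and not against [dz]: the value is [2 * PI] times the circle
    mean, and the degenerate radius 0 is meaningful. *)
Definition circ_int (k : C -> C) (r : R) : C := CI (fun t => k (circ r t)) 0 (2 * PI).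

Lemma two_PI_pos : (0 < 2 * PI)%R.
Proof. pose proof PI_RGT_0; lra. Qed.

(* Goursat for [k] composed with [exp] on [ln r1, ln r2] x [0, 2 pi]: the two
   horizontal sides cancel by periodicity. *)
Lemma circ_int_annulus (k : C -> C) (r1 r2 : R) : (0 < r1 <= r2)%R ->
  (forall z, (r1 <= Cmod z <= r2)%R -> exists l, cderiv k z l) ->
  circ_int k r1 = circ_int k r2.
Proof.
intros hr Hk; pose proof two_PI_pos as hpi.
assert (hln : (ln r1 <= ln r2)%R).
{ destruct (Req_dec r1 r2) as [->|N]; [lra|left; apply ln_increasing; lra]. }
set (F := fun w => k (cexp w)).
assert (HF : forall s t, (ln r1 <= s <= ln r2)%R -> exists l, cderiv F (s, t) l).
{ intros s t hs; destruct (Hk (cexp (s, t))) as [l Hl].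
  - unfold cexp; simpl; rewrite Cmod_circ by (left; apply exp_pos).
    rewrite <- (exp_ln r1), <- (exp_ln r2) by lra.
    split; [destruct (Req_dec (ln r1) s) as [->|N]|destruct (Req_dec s (ln r2)) as [->|N]];
      try lra; left; apply exp_increasing; lra.
  - eexists; apply (cderiv_comp k cexp); [exact Hl|apply cderiv_cexp]. }
assert (G := goursat F (ln r1) 0 (ln r2 - ln r1) (2 * PI) ltac:(lra) ltac:(lra)).
replace (ln r1 + (ln r2 - ln r1))%R with (ln r2) in G by ring.
rewrite Rplus_0_l in G.
specialize (G (fun s t hs _ => HF s t hs)).
assert (HC : forall s t, (ln r1 <= s <= ln r2)%R -> ccont F (s, t)).
{ intros s t hs; destruct (HF s t hs) as [l Hl]; exact (cderiv_ccont _ _ _ Hl). }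
assert (HP : forall s, (ln r1 <= s <= ln r2)%R ->
  path_cont_on (fun t => F (s, t)) 0 (2 * PI)).
{ intros s hs t _; apply path_cont_vertical, HC, hs. }
unfold boundary_int in G.
rewrite (CI_ext (fun s => F (s, 2 * PI)%R - F (s, 0)%R) (fun _ => 0)) in G; [|lra|].
2:{ intros s _; unfold F, cexp, circ; simpl.
    rewrite cos_2PI, sin_2PI, cos_0, sin_0; ring. }
rewrite CI_const in G.
assert (Z : CI (fun t => F (ln r2, t) - F (ln r1, t)) 0 (2 * PI) = 0).
{ replace (CI (fun t => F (ln r2, t) - F (ln r1, t)) 0 (2 * PI))
    with (Ci * (RtoC (ln r2 - ln r1) * 0
      - Ci * CI (fun t => F (ln r2, t) - F (ln r1, t)) 0 (2 * PI))).
  - rewrite G; ring.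
  - match goal with |- Ci * (_ - Ci * ?X) = _ =>
      replace X with (- (Ci * Ci) * X) at 2 end; [ring|].
    replace (- (Ci * Ci)) with (RtoC 1); [ring|].
    unfold Ci, Cmult, Copp, RtoC; simpl; f_equal; ring. }
assert (E : forall r, (r1 <= r <= r2)%R ->
  circ_int k r = CI (fun t => F (ln r, t)) 0 (2 * PI)).
{ intros r h; unfold circ_int, F, cexp; simpl; rewrite exp_ln by lra; reflexivity. }
rewrite (E r1), (E r2) by lra.
rewrite (CI_ext (fun t => F (ln r2, t))
  (fun t => (F (ln r2, t) - F (ln r1, t)) + F (ln r1, t))); [|lra|intros; ring].
rewrite CI_plus; [rewrite Z; ring|lra| |apply HP; lra].
intros t ht; apply path_cont_minus; apply HP; lra.
Qed.

(** Continuity of the mean in the radius. Uniformity in the angle comes from compactness of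
    [[0, 2 * PI]], applied to [k] as a function of radius and angle jointly. *)
Lemma circ_int_near (k : C -> C) (rho r eps : R) : (0 <= r < rho)%R ->
  (forall z, (Cmod z < rho)%R -> ccont k z) -> (0 < eps)%R ->
  exists d, (0 < d)%R /\ forall r', (0 <= r' < rho)%R -> (Rabs (r' - r) < d)%R ->
    (Cmod (circ_int k r' - circ_int k r) <= eps * (2 * PI))%R.
Proof.
intros hr Hk heps; pose proof two_PI_pos as hpi.
set (G := fun w : C => k (circ (fst w) (snd w))).
(* The factor 2 leaves room for two displacements, one in the radius and one in the angle, each
   below [e]. *)
assert (HG : forall u, exists e : posreal, forall w,
  (Cmod (w - (r, u)) < 2 * e)%R -> (Cmod (G w - G (r, u)) < eps / 2)%R).
{ intros u; destruct (Hk (circ r u)) with (eps := (eps / 2)%R) as [d1 [hd1 H1]];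
    [rewrite Cmod_circ; lra|lra|].
  destruct (circ_ccont (r, u) d1 hd1) as [d2 [hd2 H2]].
  exists (mkposreal (d2 / 2) ltac:(lra)); simpl; intros w hw.
  apply H1, (H2 w); lra. }
set (delta := fun u => proj1_sig (constructive_indefinite_description _ (HG u))).
assert (Hdelta : forall u w, (Cmod (w - (r, u)) < 2 * delta u)%R ->
  (Cmod (G w - G (r, u)) < eps / 2)%R).
{ intros u; exact (proj2_sig (constructive_indefinite_description _ (HG u))). }
clearbody delta.
destruct (compactness_value_1d 0 (2 * PI) delta) as [d Hd].
exists (pos d); split; [apply cond_pos|]; intros r' hr' hd.
assert (P : forall x, (0 <= x < rho)%R ->
  path_cont_on (fun t => k (circ x t)) 0 (2 * PI)).
{ intros x hx t _; apply circ_path_cont, Hk; rewrite Cmod_circ; lra. }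
assert (E : circ_int k r' - circ_int k r
  = CI (fun t => k (circ r' t) - k (circ r t)) 0 (2 * PI)).
{ unfold circ_int.
  rewrite (CI_ext (fun t => k (circ r' t))
    (fun t => (k (circ r' t) - k (circ r t)) + k (circ r t))); [|lra|intros; ring].
  rewrite CI_plus; [ring|lra| |apply P; lra].
  intros t ht; apply path_cont_minus; apply P; lra. }
rewrite E.
replace (eps * (2 * PI))%R with ((2 * PI - 0) * eps)%R by ring.
apply CI_bound; [lra| |].
{ intros t ht; apply path_cont_minus; apply P; lra. }
(* [compactness_value_1d] provides the centre [u] only under a double negation, so the bound is
   proved by contradiction. *)
intros t ht; apply Rnot_lt_le; intros N.
apply (Hd t ht); intros [u [hu [h1 h2]]].
apply (Rlt_not_le _ _ N).
assert (A1 := Hdelta u (r', t)); assert (A2 := Hdelta u (r, t)).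
unfold G in A1, A2; simpl in A1, A2.
replace (k (circ r' t) - k (circ r t))
  with ((k (circ r' t) - k (circ r u)) - (k (circ r t) - k (circ r u))) by ring.
eapply Rle_trans; [apply Cmod_triangle|]; rewrite Cmod_opp.
assert (B1 : (Cmod ((r', t) - (r, u)) < 2 * delta u)%R)
  by (eapply Rle_lt_trans; [apply Cmod_le_sum|]; lra).
assert (B2 : (Cmod ((r, t) - (r, u)) < 2 * delta u)%R)
  by (rewrite Cmod_pair_snd; pose proof (Rabs_pos (t - u)); lra).
specialize (A1 B1); specialize (A2 B2); lra.
Qed.

(** The closed annulus from [r1 + e / 2] to [r2 - e / 2] lies where [k] is differentiable;
    continuity in the radius lets [e] tend to 0. This admits bounding circles on which [k] is merely
    continuous, and [r1 = 0]. *)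
Lemma circ_int_open_annulus (k : C -> C) (rho r1 r2 : R) :
  (0 <= r1 <= r2)%R -> (r2 < rho)%R ->
  (forall z, (Cmod z < rho)%R -> ccont k z) ->
  (forall z, (r1 < Cmod z < r2)%R -> exists l, cderiv k z l) ->
  circ_int k r1 = circ_int k r2.
Proof.
intros h12 h2 Hc Hk; pose proof two_PI_pos as hpi.
destruct (Req_dec r1 r2) as [->|N]; [reflexivity|].
assert (E : (Cmod (circ_int k r1 - circ_int k r2) <= 0)%R).
{ apply (Rle_0_of_le_mul _ (2 * (2 * PI))); [lra|]; intros eps heps.
  destruct (circ_int_near k rho r1 eps ltac:(lra) Hc heps) as [d1 [hd1 H1]].
  destruct (circ_int_near k rho r2 eps ltac:(lra) Hc heps) as [d2 [hd2 H2]].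
  set (e := Rmin (Rmin d1 d2) (r2 - r1)).
  assert (he : (0 < e)%R) by (repeat apply Rmin_glb_lt; lra).
  assert (e1 : (e <= d1)%R) by (eapply Rle_trans; apply Rmin_l).
  assert (e2 : (e <= d2)%R) by (eapply Rle_trans; [apply Rmin_l|apply Rmin_r]).
  assert (e3 : (e <= r2 - r1)%R) by apply Rmin_r.
  specialize (H1 (r1 + e / 2)%R ltac:(lra)); specialize (H2 (r2 - e / 2)%R ltac:(lra)).
  rewrite (circ_int_annulus k (r1 + e / 2) (r2 - e / 2)) in H1;
    [|lra|intros; apply Hk; lra].
  replace (r1 + e / 2 - r1)%R with (e / 2)%R in H1 by ring.
  replace (r2 - e / 2 - r2)%R with (- (e / 2))%R in H2 by ring.
  rewrite Rabs_Ropp in H2; rewrite Rabs_pos_eq in H1, H2 by lra.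
  specialize (H1 ltac:(lra)); specialize (H2 ltac:(lra)).
  eapply Rle_trans; [apply (Cmod_triang_via _ (circ_int k (r2 - e / 2)))|].
  rewrite Cmod_minus_sym; lra. }
assert (Z : circ_int k r1 - circ_int k r2 = 0)
  by (apply Cmod_eq_0, Rle_antisym; [exact E|apply Cmod_ge_0]).
replace (circ_int k r1) with ((circ_int k r1 - circ_int k r2) + circ_int k r2) by ring.
rewrite Z; ring.
Qed.

(** The mean over the circle of radius 0 is [k 0]. From there the radius grows to [r] through at
    most two open annuli, separated by the exceptional circle of radius [r0]. *)
Lemma mean_value (k : C -> C) (rho r0 r : R) : (0 <= r0)%R -> (0 <= r < rho)%R ->
  (forall z, (Cmod z < rho)%R -> ccont k z) ->
  (forall z, (Cmod z < rho)%R -> z <> 0 -> Cmod z <> r0 -> exists l, cderiv k z l) ->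
  circ_int k r = RtoC (2 * PI) * k 0.
Proof.
intros h0 hr Hc Hk.
assert (E : circ_int k 0 = RtoC (2 * PI) * k 0).
{ unfold circ_int; rewrite (CI_ext _ (fun _ => k 0)).
  - rewrite CI_const; f_equal; f_equal; ring.
  - pose proof two_PI_pos; lra.
  - intros t _; f_equal; unfold circ, RtoC; f_equal; ring. }
assert (NZ : forall z, (0 < Cmod z)%R -> z <> 0) by (intros z hz; apply Cmod_gt_0, hz).
rewrite <- E; symmetry.
destruct (Rle_lt_dec r r0) as [h|h].
- apply (circ_int_open_annulus k rho); [lra|lra|exact Hc|].
  intros z hz; apply Hk; [lra|apply NZ; lra|lra].
- rewrite (circ_int_open_annulus k rho 0 r0); [|lra|lra|exact Hc|].
  + apply (circ_int_open_annulus k rho); [lra|lra|exact Hc|].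
    intros z hz; apply Hk; [lra|apply NZ; lra|lra].
  + intros z hz; apply Hk; [lra|apply NZ; lra|lra].
Qed.

(** * Cauchy's formula and the Schwarz lemma *)

Definition diff_quot (f : C -> C) (a l z : C) : C :=
  if Ceq_dec z a then l else (f z - f a) / (z - a).

Lemma Cminus_neq_0 (a b : C) : a <> b -> a - b <> 0.
Proof.
intros N E; apply N; replace a with ((a - b) + b) by ring; rewrite E; ring.
Qed.

Lemma cderiv_shift (a z : C) : cderiv (fun w => w - a) z 1.
Proof.
apply (cderiv_eq _ _ (1 + 0)); [|ring].
apply (cderiv_plus (fun w => w) (fun _ => - a)); [apply cderiv_id|apply cderiv_const].
Qed.

Lemma diff_quot_off (f : C -> C) (a l z : C) : z <> a ->
  diff_quot f a l z = (f z - f a) / (z - a).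
Proof. intros N; unfold diff_quot; destruct Ceq_dec; [contradiction|reflexivity]. Qed.

Lemma diff_quot_near (f : C -> C) (a l z w : C) :
  (Cmod (w - z) < Cmod (z - a))%R -> (f w - f a) / (w - a) = diff_quot f a l w.
Proof.
intros h; symmetry; apply diff_quot_off; intros ->.
rewrite Cmod_minus_sym in h; lra.
Qed.

Lemma diff_quot_cderiv (f : C -> C) (a l z m : C) : z <> a -> cderiv f z m ->
  exists m', cderiv (diff_quot f a l) z m'.
Proof.
intros N H; eexists.
apply (cderiv_ext_loc (fun w => (f w - f a) / (w - a)) _ _ _ (Cmod (z - a))).
- apply Cmod_gt_0, Cminus_neq_0, N.
- intros w hw; apply (diff_quot_near f a l z w hw).
- apply (cderiv_div (fun w => f w - f a) (fun w => w - a));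
    [apply Cminus_neq_0, N| |apply cderiv_shift].
  apply (cderiv_plus f (fun _ => - f a)); [exact H|apply cderiv_const].
Qed.

Lemma diff_quot_ccont_off (f : C -> C) (a l z : C) : z <> a -> ccont f z ->
  ccont (diff_quot f a l) z.
Proof.
intros N H.
apply (ccont_ext_loc (fun w => (f w - f a) / (w - a)) _ _ (Cmod (z - a))).
- apply Cmod_gt_0, Cminus_neq_0, N.
- intros w hw; apply (diff_quot_near f a l z w hw).
- apply (ccont_mult (fun w => f w - f a) (fun w => / (w - a))).
  + intros eps heps; destruct (H eps heps) as [d [hd Hd]].
    exists d; split; [exact hd|]; intros w hw.
    replace (f w - f a - (f z - f a)) with (f w - f z) by ring; apply Hd, hw.
  + eapply cderiv_ccont, (cderiv_comp Cinv (fun w => w - a));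
      [apply cderiv_Cinv, Cminus_neq_0, N|apply cderiv_shift].
Qed.

Lemma diff_quot_ccont_at (f : C -> C) (a l : C) : cderiv f a l ->
  ccont (diff_quot f a l) a.
Proof.
intros H eps heps; destruct (H (eps / 2)%R ltac:(lra)) as [d [hd Hd]].
exists d; split; [exact hd|]; intros w hw.
unfold diff_quot at 2; destruct (Ceq_dec a a) as [_|N]; [|contradiction N; reflexivity].
unfold diff_quot; destruct (Ceq_dec w a) as [E|N].
- rewrite Cmod_minus_self; exact heps.
- specialize (Hd w hw).
  assert (h0 : w - a <> 0) by (apply Cminus_neq_0, N).
  replace ((f w - f a) / (w - a) - l) with ((f w - f a - l * (w - a)) / (w - a))
    by (field; exact h0).
  rewrite Cmod_div by exact h0.
  apply Cmod_gt_0 in h0.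
  apply (Rmult_lt_reg_r (Cmod (w - a))); [exact h0|].
  unfold Rdiv; rewrite Rmult_assoc, Rinv_l, Rmult_1_r by lra.
  eapply Rle_lt_trans; [exact Hd|]; apply Rmult_lt_compat_r; lra.
Qed.

Lemma circ_conj (r t : R) : circ r t * Cconj (circ r t) = RtoC (r * r).
Proof.
pose proof (sin2_cos2 t) as H; unfold Rsqr in H.
unfold circ, Cmult, Cconj, RtoC; simpl; f_equal; [|ring].
replace (r * r)%R with (r * r * (sin t * sin t + cos t * cos t))%R at 1
  by (rewrite H; ring).
ring.
Qed.

Lemma circ_neq (r t : R) (a : C) : (Cmod a < r)%R -> circ r t - a <> 0.
Proof.
intros h; apply Cminus_neq_0; intros E.
pose proof (Cmod_ge_0 a); assert (X := Cmod_circ r t ltac:(lra)).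
rewrite E in X; lra.
Qed.

(* On [|w| = r] the kernel [w / (w - a)] is the conjugate of
   [r^2 / (r^2 - conj a * w)], which is holomorphic on [|w| < r^2 / |a|]. *)
Lemma cauchy_kernel_int (r : R) (a : C) : (Cmod a < r)%R -> a <> 0 ->
  circ_int (fun w => w / (w - a)) r = RtoC (2 * PI).
Proof.
intros har ha; pose proof two_PI_pos as hpi.
assert (ha0 : (0 < Cmod a)%R) by (apply Cmod_gt_0, ha).
set (h := fun w => RtoC (r * r) / (RtoC (r * r) - Cconj a * w)).
assert (hrr : (0 < r * r)%R) by nra.
assert (den : forall w, (Cmod w < r * r / Cmod a)%R ->
  RtoC (r * r) - Cconj a * w <> 0).
{ intros w hw; apply Cminus_neq_0; intros E.
  assert (X := f_equal Cmod E).
  rewrite Cmod_R, Cmod_mult, Cmod_conj, Rabs_pos_eq in X by lra.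
  apply (Rmult_lt_compat_l (Cmod a)) in hw; [|exact ha0].
  replace (Cmod a * (r * r / Cmod a))%R with (r * r)%R in hw by (field; lra).
  lra. }
assert (D : forall w, (Cmod w < r * r / Cmod a)%R -> exists l, cderiv h w l).
{ intros w hw; eexists.
  apply (cderiv_div (fun _ => RtoC (r * r)) (fun w => RtoC (r * r) - Cconj a * w));
    [apply den, hw|apply cderiv_const|].
  apply (cderiv_plus (fun _ => RtoC (r * r)) (fun w => - (Cconj a * w)));
    [apply cderiv_const|].
  apply (cderiv_ext_loc (fun w => - Cconj a * w) _ _ _ 1 Rlt_0_1);
    [intros; ring|apply cderiv_scal, cderiv_id]. }
assert (hbig : (r < r * r / Cmod a)%R).
{ apply (Rmult_lt_reg_r (Cmod a)); [exact ha0|].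
  replace (r * r / Cmod a * Cmod a)%R with (r * r)%R by (field; lra). nra. }
assert (M := mean_value h (r * r / Cmod a) 0 r ltac:(lra) ltac:(lra)
  (fun z hz => let (l, Hl) := D z hz in cderiv_ccont _ _ _ Hl)
  (fun z hz _ _ => D z hz)).
assert (h0 : h 0 = 1).
{ unfold h; replace (RtoC (r * r) - Cconj a * 0) with (RtoC (r * r)) by ring.
  field; intros E; apply RtoC_inj in E; lra. }
rewrite h0, Cmult_1_r in M.
transitivity (Cconj (circ_int h r)).
- unfold circ_int; rewrite <- CI_conj; [|lra|].
  + apply CI_ext; [lra|]; intros t _.
    pose proof (den (circ r t) ltac:(rewrite Cmod_circ; lra)) as dt.
    unfold h; rewrite Cdiv_conj by exact dt.
    rewrite Cminus_conj, Cmult_conj, Cconj_conj.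
    replace (Cconj (RtoC (r * r))) with (RtoC (r * r))
      by (unfold Cconj, RtoC; simpl; f_equal; ring).
    rewrite <- (circ_conj r t).
    assert (cn : circ r t <> 0) by (apply Cmod_gt_0; rewrite Cmod_circ; lra).
    assert (cn' : Cconj (circ r t) <> 0)
      by (apply Cmod_gt_0; rewrite Cmod_conj, Cmod_circ; lra).
    pose proof (circ_neq r t a har) as ca.
    field; repeat split; try assumption.
    replace (circ r t * Cconj (circ r t) - a * Cconj (circ r t))
      with ((circ r t - a) * Cconj (circ r t)) by ring.
    apply Cmult_neq_0; assumption.
  + intros t _; apply circ_path_cont.
    destruct (D (circ r t)) as [l Hl]; [rewrite Cmod_circ; lra|].
    exact (cderiv_ccont _ _ _ Hl).
- rewrite M; unfold Cconj, RtoC; simpl; f_equal; ring.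
Qed.

Lemma kernel_ccont (r t : R) (a : C) : (Cmod a < r)%R ->
  ccont (fun w => w / (w - a)) (circ r t).
Proof.
intros h; eapply cderiv_ccont, (cderiv_div (fun w => w) (fun w => w - a));
  [apply circ_neq, h|apply cderiv_id|apply cderiv_shift].
Qed.

(** The function [k] has mean 0 because [k 0 = 0]. On the circle, [g w * (w / (w - a))] is
    [k w + g a * (w / (w - a))], so only [g a] times the kernel integral survives. *)
Lemma cauchy_formula (g : C -> C) (rho r : R) (a : C) :
  (r < rho)%R -> (Cmod a < r)%R ->
  (forall z, (Cmod z < rho)%R -> ccont g z) ->
  (forall z, (Cmod z < rho)%R -> z <> 0 -> exists l, cderiv g z l) ->
  circ_int (fun w => g w * (w / (w - a))) r = RtoC (2 * PI) * g a.
Proof.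
intros hr har Hc Hd; pose proof two_PI_pos as hpi; pose proof (Cmod_ge_0 a) as ha0.
(* At [a = 0] no derivative of [g] is available to complete the difference quotient; but there the
   kernel is 1 and the claim is the mean value property. *)
destruct (Ceq_dec a 0) as [->|ha].
- rewrite <- (mean_value g rho 0 r); [|lra|lra|exact Hc|intros; apply Hd; assumption].
  apply CI_ext; [lra|]; intros t _.
  pose proof (circ_neq r t 0 har) as N.
  replace (circ r t - 0) with (circ r t) in * by ring; field; exact N.
- destruct (Hd a ltac:(lra) ha) as [l Hl].
  set (k := fun z => z * diff_quot g a l z).
  assert (M : circ_int k r = RtoC (2 * PI) * k 0).
  { apply (mean_value k rho (Cmod a)); [lra|lra| |].
    - intros z hz; apply (ccont_mult (fun z => z)).
      + eapply cderiv_ccont, cderiv_id.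
      + destruct (Ceq_dec z a) as [->|N];
          [apply diff_quot_ccont_at, Hl|apply diff_quot_ccont_off; auto].
    - intros z hz z0 za.
      destruct (Hd z hz z0) as [m Hm].
      destruct (diff_quot_cderiv g a l z m) as [m' Hm']; [intros ->; auto|exact Hm|].
      eexists; apply (cderiv_mult (fun z => z)); [apply cderiv_id|exact Hm']. }
  replace (k 0) with (RtoC 0) in M by (unfold k; ring).
  rewrite Cmult_0_r in M.
  assert (Pg : path_cont_on (fun t => k (circ r t)) 0 (2 * PI)).
  { intros t _; apply circ_path_cont, (ccont_mult (fun z => z));
      [eapply cderiv_ccont, cderiv_id|].
    apply diff_quot_ccont_off;
      [intros E; apply (circ_neq r t a har); rewrite E; ring|].
    apply Hc; rewrite Cmod_circ; lra. }
  assert (Pk : path_cont_on (fun t => circ r t / (circ r t - a)) 0 (2 * PI)).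
  { intros t _; apply (circ_path_cont (fun w => w / (w - a))), kernel_ccont, har. }
  transitivity (circ_int k r + g a * circ_int (fun w => w / (w - a)) r).
  + unfold circ_int; rewrite <- CI_scal, <- CI_plus; try lra; try assumption.
    * apply CI_ext; [lra|]; intros t _.
      pose proof (circ_neq r t a har) as N.
      unfold k; rewrite diff_quot_off by (intros E; apply N; rewrite E; ring).
      field; exact N.
    * intros t ht; apply (path_cont_comp (fun w => g a * w)); [|apply Pk, ht].
      eapply cderiv_ccont, cderiv_scal, cderiv_id.
  + rewrite M, cauchy_kernel_int by assumption; ring.
Qed.

Lemma cauchy_estimate (g : C -> C) (rho r B : R) (a : C) :
  (r < rho)%R -> (Cmod a < r)%R ->
  (forall z, (Cmod z < rho)%R -> ccont g z) ->
  (forall z, (Cmod z < rho)%R -> z <> 0 -> exists l, cderiv g z l) ->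
  (forall z, Cmod z = r -> (Cmod (g z) <= B)%R) ->
  (Cmod (g a) <= B * (r / (r - Cmod a)))%R.
Proof.
intros hr har Hc Hd HB; pose proof two_PI_pos as hpi; pose proof (Cmod_ge_0 a) as ha0.
assert (X := cauchy_formula g rho r a hr har Hc Hd).
apply (f_equal Cmod) in X; rewrite Cmod_mult, Cmod_R, Rabs_pos_eq in X by lra.
apply (Rmult_le_reg_l (2 * PI)); [exact hpi|]; rewrite <- X.
rewrite <- (Rminus_0_r (2 * PI)).
apply CI_bound; [lra| |].
- intros t _; apply (circ_path_cont (fun w => g w * (w / (w - a)))), ccont_mult;
    [|apply kernel_ccont, har].
  apply Hc; rewrite Cmod_circ; lra.
- intros t _; pose proof (circ_neq r t a har) as N.
  rewrite Cmod_mult, Cmod_div, Cmod_circ by (assumption || lra).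
  apply Rmult_le_compat; [apply Cmod_ge_0| |apply HB, Cmod_circ; lra|].
  + apply Rmult_le_pos; [lra|]; left; apply Rinv_0_lt_compat, Cmod_gt_0, N.
  + apply Rmult_le_compat_l; [lra|]; apply Rinv_le_contravar; [lra|].
    pose proof (Cmod_rev_triang (circ r t) a) as T; rewrite Cmod_circ in T; lra.
Qed.

(** If [x = B * (1 + h)] with [h > 0], Bernoulli's inequality makes [(x / B)^n] at least
    [1 + n * h], which exceeds [K] for large [n]. *)
Lemma Rle_of_pow_le (x B K : R) : (0 < B)%R ->
  (forall n, (x ^ n <= B ^ n * K)%R) -> (x <= B)%R.
Proof.
intros hB H; apply Rnot_lt_le; intros hx.
set (h := (x / B - 1)%R).
assert (hh : (0 < h)%R).
{ unfold h; apply (Rmult_lt_reg_r B); [exact hB|].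
  replace ((x / B - 1) * B)%R with (x - B)%R by (field; lra); lra. }
destruct (INR_unbounded (K / h)) as [n Hn].
assert (P := poly n h hh).
assert (E : (x = B * (1 + h))%R) by (unfold h; field; lra).
specialize (H n); rewrite E, Rpow_mult_distr in H.
apply Rmult_le_reg_l in H; [|apply pow_lt, hB].
apply (Rmult_lt_compat_r h) in Hn; [|exact hh].
replace (K / h * h)%R with K in Hn by (field; lra).
lra.
Qed.

(* Applying the Cauchy estimate to the powers [g^n] removes the constant. *)
Lemma max_modulus (g : C -> C) (rho r B : R) (a : C) :
  (r < rho)%R -> (Cmod a < r)%R -> (0 < B)%R ->
  (forall z, (Cmod z < rho)%R -> ccont g z) ->
  (forall z, (Cmod z < rho)%R -> z <> 0 -> exists l, cderiv g z l) ->
  (forall z, Cmod z = r -> (Cmod (g z) <= B)%R) ->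
  (Cmod (g a) <= B)%R.
Proof.
intros hr har hB Hc Hd HB.
apply (Rle_of_pow_le _ _ (r / (r - Cmod a)) hB); intros n.
rewrite <- Cmod_pow.
apply (cauchy_estimate (fun z => g z ^ n) rho); [exact hr|exact har| | |].
- intros z hz; apply ccont_pow, Hc, hz.
- intros z hz z0; destruct (Hd z hz z0) as [l Hl]; apply (cderiv_pow g z l n Hl).
- intros z hz; rewrite Cmod_pow; apply pow_incr; split; [apply Cmod_ge_0|apply HB, hz].
Qed.

(** Expand the Cauchy kernel at [h] as [w / (w - h) = 1 + h / w + h^2 / (w * (w - h))]. The first
    term gives [g 0] by the mean value property, the second the candidate derivative times [h], and
    the third is of order [h^2]. *)
Lemma removable_singularity (g : C -> C) (rho r B : R) :
  (0 < r < rho)%R -> (0 < B)%R ->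
  (forall z, (Cmod z < rho)%R -> ccont g z) ->
  (forall z, (Cmod z < rho)%R -> z <> 0 -> exists l, cderiv g z l) ->
  (forall z, Cmod z = r -> (Cmod (g z) <= B)%R) ->
  exists l, cderiv g 0 l.
Proof.
intros hr hB Hc Hd HB; pose proof two_PI_pos as hpi.
set (c := circ_int (fun w => g w * / w) r).
assert (tp : RtoC (2 * PI) <> 0) by (intros E; apply RtoC_inj in E; lra).
exists (c / RtoC (2 * PI)).
intros eps heps.
(* For [|w| = r] and [|h| < r / 2] one has [|w * (w - h)| >= r * r / 2], so [K * |h|^2] bounds the
   third term of the expansion; [|h| < eps / K] brings it below [eps * |h|]. *)
set (K := (B * (2 / (r * r)))%R).
assert (hK : (0 < K)%R).
{ apply Rmult_lt_0_compat; [lra|]; apply Rdiv_lt_0_compat; [lra|]; nra. }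
exists (Rmin (r / 2) (eps / K)); split.
{ apply Rmin_glb_lt; [lra|apply Rdiv_lt_0_compat; lra]. }
intros h hh; replace (h - 0) with h in * by ring.
assert (h1 : (Cmod h < r / 2)%R) by (eapply Rlt_le_trans; [exact hh|apply Rmin_l]).
assert (h2 : (Cmod h < eps / K)%R) by (eapply Rlt_le_trans; [exact hh|apply Rmin_r]).
assert (c0 : forall t, circ r t <> 0)
  by (intros t; apply Cmod_gt_0; rewrite Cmod_circ; lra).
assert (F1 := cauchy_formula g rho r h ltac:(lra) ltac:(lra) Hc Hd).
assert (F0 := mean_value g rho 0 r ltac:(lra) ltac:(lra) Hc
                (fun z hz z0 _ => Hd z hz z0)).
assert (Pg : forall t, ccont g (circ r t)) by (intros t; apply Hc; rewrite Cmod_circ; lra).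
assert (Pi : forall t, ccont (fun w => / w) (circ r t))
  by (intros t; eapply cderiv_ccont, cderiv_Cinv, c0).
assert (Pr : forall t, ccont (fun w => g w * (h * h * (/ w * (w / (w - h)) * / w))) (circ r t)).
{ intros t; apply ccont_mult; [apply Pg|].
  apply (ccont_mult (fun _ => h * h)); [apply ccont_const|].
  apply (ccont_mult (fun w => / w * (w / (w - h)))); [|apply Pi].
  apply ccont_mult; [apply Pi|apply kernel_ccont; lra]. }
assert (Q1 : path_cont_on (fun t => g (circ r t) * (circ r t / (circ r t - h))) 0 (2 * PI)).
{ intros t _; apply (circ_path_cont (fun w => g w * (w / (w - h)))).
  apply ccont_mult; [apply Pg|apply kernel_ccont; lra]. }
assert (Q2 : path_cont_on (fun t => g (circ r t)) 0 (2 * PI))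
  by (intros t _; apply circ_path_cont, Pg).
assert (Q3 : path_cont_on (fun t => g (circ r t) * / circ r t) 0 (2 * PI)).
{ intros t _; apply (circ_path_cont (fun w => g w * / w)), ccont_mult;
    [apply Pg|apply Pi]. }
assert (Qs : forall (b : C) f, path_cont_on f 0 (2 * PI) ->
  path_cont_on (fun t => b * f t) 0 (2 * PI)).
{ intros b f Hf t ht; apply (path_cont_comp (fun w => b * w)); [|apply Hf, ht].
  eapply cderiv_ccont, cderiv_scal, cderiv_id. }
assert (E : RtoC (2 * PI) * (g h - g 0 - c / RtoC (2 * PI) * h)
  = circ_int (fun w => g w * (h * h * (/ w * (w / (w - h)) * / w))) r).
{ replace (RtoC (2 * PI) * (g h - g 0 - c / RtoC (2 * PI) * h))
    with (RtoC (2 * PI) * g h + ((-1) * (RtoC (2 * PI) * g 0) + - h * c))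
    by (field; exact tp).
  rewrite <- F1, <- F0; unfold c, circ_int.
  rewrite <- (CI_scal (-1)), <- (CI_scal (- h)) by (assumption || lra).
  rewrite <- (CI_plus (fun t => -1 * g (circ r t)))
    by (lra || apply (Qs _ _ Q2) || apply (Qs _ _ Q3)).
  rewrite <- CI_plus; [|lra|exact Q1|].
  - apply CI_ext; [lra|]; intros t _.
    pose proof (circ_neq r t h ltac:(lra)) as N; field; split; [apply c0|exact N].
  - intros t ht; apply path_cont_plus; [apply (Qs _ _ Q2 t ht)|apply (Qs _ _ Q3 t ht)]. }
apply (f_equal Cmod) in E; rewrite Cmod_mult, Cmod_R, Rabs_pos_eq in E by lra.
apply (Rmult_le_reg_l (2 * PI)); [exact hpi|]; rewrite E.
apply Rle_trans with ((2 * PI - 0) * (K * (Cmod h * Cmod h)))%R.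
- apply CI_bound; [lra| |].
  + intros t _.
    apply (circ_path_cont (fun w => g w * (h * h * (/ w * (w / (w - h)) * / w)))), Pr.
  + intros t _; pose proof (circ_neq r t h ltac:(lra)) as N.
    replace (/ circ r t * (circ r t / (circ r t - h)) * / circ r t)
      with (/ ((circ r t - h) * circ r t)) by (field; split; [apply c0|exact N]).
    rewrite !Cmod_mult, Cmod_inv, Cmod_mult, Cmod_circ
      by (lra || (apply Cmult_neq_0; [exact N|apply c0])).
    unfold K.
    replace (B * (2 / (r * r)) * (Cmod h * Cmod h))%R
      with (B * (Cmod h * Cmod h * (2 / (r * r))))%R by ring.
    apply Rmult_le_compat; [apply Cmod_ge_0| |apply HB, Cmod_circ; lra|].
    { apply Rmult_le_pos; [apply Rmult_le_pos; apply Cmod_ge_0|].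
      left; apply Rinv_0_lt_compat, Rmult_lt_0_compat; [apply Cmod_gt_0, N|lra]. }
    apply Rmult_le_compat_l; [apply Rmult_le_pos; apply Cmod_ge_0|].
    replace (2 / (r * r))%R with (/ (r / 2 * r))%R by (field; lra).
    apply Rinv_le_contravar; [nra|].
    apply Rmult_le_compat_r; [lra|].
    pose proof (Cmod_rev_triang (circ r t) h) as T; rewrite Cmod_circ in T; lra.
- rewrite Rminus_0_r; apply Rmult_le_compat_l; [lra|].
  apply (Rmult_lt_compat_l K) in h2; [|exact hK].
  replace (K * (eps / K))%R with eps in h2 by (field; lra).
  rewrite <- Rmult_assoc; apply Rmult_le_compat_r; [apply Cmod_ge_0|lra].
Qed.

(** The quotient [q = k z / z], completed by the derivative at 0, is continuous there, so its
    singularity is removable. On [|z| = r] it is at most [1 / r], and by the maximum principle this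
    holds inside as well; [r] may be taken arbitrarily close to 1. *)
Lemma schwarz_lemma (k : C -> C) : schur_class k -> k 0 = 0 ->
  exists q, schur_class q /\ forall z, in_disc z -> k z = z * q z.
Proof.
intros [Ha Hb] k0.
assert (D : forall z, (Cmod z < 1)%R -> exists l, cderiv k z l)
  by (intros z hz; apply ex_derive_cderiv, Ha, hz).
assert (z1 : (Cmod 0 < 1)%R) by (rewrite Cmod_0; lra).
destruct (D 0 z1) as [l Hl].
set (q := diff_quot k 0 l).
assert (off : forall z : C, z <> 0 -> q z = k z / z).
{ intros z hz; unfold q; rewrite diff_quot_off, k0 by exact hz; field; exact hz. }
assert (Hc : forall z, (Cmod z < 1)%R -> ccont q z).
{ intros z hz; destruct (Ceq_dec z 0) as [->|N];
    [apply diff_quot_ccont_at, Hl|apply diff_quot_ccont_off; [exact N|]].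
  destruct (D z hz) as [m Hm]; exact (cderiv_ccont _ _ _ Hm). }
assert (Hd : forall z, (Cmod z < 1)%R -> z <> RtoC 0 -> exists m, cderiv q z m).
{ intros z hz N; destruct (D z hz) as [m Hm]; apply (diff_quot_cderiv k 0 l z m N Hm). }
assert (B : forall r z, (0 < r < 1)%R -> Cmod z = r -> (Cmod (q z) <= / r)%R).
{ intros r z hr hz.
  assert (N : z <> 0) by (apply Cmod_gt_0; lra).
  rewrite off, Cmod_div, hz by exact N.
  replace (/ r)%R with (1 * / r)%R by ring.
  apply Rmult_le_compat_r; [left; apply Rinv_0_lt_compat; lra|].
  apply Hb; unfold in_disc; lra. }
exists q; split; [split|].
- intros z hz; apply ex_derive_cderiv.
  destruct (Ceq_dec z 0) as [->|N]; [|apply Hd; assumption].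
  apply (removable_singularity q 1 (1 / 2) (/ (1 / 2))); [lra|lra|exact Hc|exact Hd|].
  intros z hz'; apply B; [lra|exact hz'].
- intros a ha; unfold in_disc in ha; apply Rnot_lt_le; intros N.
  pose proof (Cmod_ge_0 a) as a0.
  set (x := Cmod (q a)) in *.
  assert (ix : (/ x < 1)%R) by (rewrite <- Rinv_1; apply Rinv_lt_contravar; lra).
  assert (ix0 : (0 < / x)%R) by (apply Rinv_0_lt_compat; lra).
  (* If [x = |q a| > 1], both [|a|] and [1 / x] are below 1; the midpoints towards 1 give a radius
     [r < 1] enclosing [a] with [1 / r < x]. *)
  set (r := Rmax ((Cmod a + 1) / 2) ((/ x + 1) / 2)).
  assert (r1 : ((Cmod a + 1) / 2 <= r)%R) by apply Rmax_l.
  assert (r2 : ((/ x + 1) / 2 <= r)%R) by apply Rmax_r.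
  assert (r3 : (r < 1)%R) by (apply Rmax_lub_lt; lra).
  assert (X : (x <= / r)%R).
  { apply (max_modulus q 1 r); [exact r3|lra|apply Rinv_0_lt_compat; lra|exact Hc|exact Hd|].
    intros z hz; apply B; [lra|exact hz]. }
  assert (Y : (/ r < / / x)%R) by (apply Rinv_lt_contravar; [apply Rmult_lt_0_compat|]; lra).
  rewrite Rinv_inv in Y; lra.
- intros z _; destruct (Ceq_dec z 0) as [->|N].
  + rewrite k0; ring.
  + rewrite off by exact N; field; exact N.
Qed.

(** * The Schur step *)

Lemma Cmod_sqr (z : C) : RtoC (Cmod z * Cmod z) = z * Cconj z.
Proof. rewrite <- Cmod2_conj; f_equal; ring. Qed.

Lemma Cmod_mult_lt_1 (a z : C) : (Cmod a < 1)%R -> (Cmod z <= 1)%R ->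
  (Cmod (a * z) < 1)%R.
Proof.
intros ha hz; rewrite Cmod_mult; pose proof (Cmod_ge_0 a); pose proof (Cmod_ge_0 z); nra.
Qed.

Lemma one_plus_neq_0 (u : C) : (Cmod u < 1)%R -> 1 + u <> 0.
Proof.
intros h E; assert (X : u = - (1)) by (replace u with ((1 + u) - 1) by ring; rewrite E; ring).
rewrite X, Cmod_m1 in h; lra.
Qed.

Lemma mobius_den (a z : C) : (Cmod a < 1)%R -> (Cmod z <= 1)%R ->
  1 + Cconj a * z <> 0.
Proof.
intros ha hz; apply one_plus_neq_0, Cmod_mult_lt_1; [rewrite Cmod_conj; exact ha|exact hz].
Qed.

Lemma one_minus_sqr_neq_0 (a : C) : (Cmod a < 1)%R -> 1 - a * Cconj a <> 0.
Proof.
intros ha; apply (one_plus_neq_0 (- (a * Cconj a))); rewrite Cmod_opp.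
apply Cmod_mult_lt_1; [exact ha|rewrite Cmod_conj; lra].
Qed.

(** Source of all modulus estimates for disc automorphisms: for [|a| < 1] the sign of [1 - |z|^2]
    decides which of denominator and numerator of [mobius a z] is larger. It is an identity for
    every [z], so it serves outside the disc too. *)
Lemma mobius_identity (a z : C) :
  (Cmod (1 + Cconj a * z) * Cmod (1 + Cconj a * z) - Cmod (z + a) * Cmod (z + a)
   = (1 - Cmod a * Cmod a) * (1 - Cmod z * Cmod z))%R.
Proof.
apply RtoC_inj; rewrite (RtoC_mult (1 - _)), !RtoC_minus, !Cmod_sqr.
rewrite !Cplus_conj, Cmult_conj, Cconj_conj.
replace (Cconj 1) with (RtoC 1) by (unfold Cconj, RtoC; simpl; f_equal; ring).
ring.
Qed.

Lemma mobius_le (a z : C) : (Cmod a < 1)%R -> (Cmod z <= 1)%R ->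
  (Cmod (mobius a z) <= 1)%R.
Proof.
intros ha hz; pose proof (mobius_den a z ha hz) as N; unfold mobius.
rewrite Cmod_div by exact N; apply Cmod_gt_0 in N.
apply (Rmult_le_reg_r (Cmod (1 + Cconj a * z))); [exact N|].
unfold Rdiv; rewrite Rmult_assoc, Rinv_l, Rmult_1_r, Rmult_1_l by lra.
pose proof (mobius_identity a z) as I.
pose proof (Cmod_ge_0 a); pose proof (Cmod_ge_0 z); pose proof (Cmod_ge_0 (z + a)).
assert (0 <= (1 - Cmod a * Cmod a) * (1 - Cmod z * Cmod z))%R
  by (apply Rmult_le_pos; nra).
nra.
Qed.

Lemma mobius_lt (a z : C) : (Cmod a < 1)%R -> (Cmod z < 1)%R ->
  (Cmod (mobius a z) < 1)%R.
Proof.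
intros ha hz; pose proof (mobius_den a z ha (Rlt_le _ _ hz)) as N; unfold mobius.
rewrite Cmod_div by exact N; apply Cmod_gt_0 in N.
apply (Rmult_lt_reg_r (Cmod (1 + Cconj a * z))); [exact N|].
unfold Rdiv; rewrite Rmult_assoc, Rinv_l, Rmult_1_r, Rmult_1_l by lra.
pose proof (mobius_identity a z) as I.
pose proof (Cmod_ge_0 a); pose proof (Cmod_ge_0 z); pose proof (Cmod_ge_0 (z + a)).
assert (0 < (1 - Cmod a * Cmod a) * (1 - Cmod z * Cmod z))%R
  by (apply Rmult_lt_0_compat; nra).
nra.
Qed.

Lemma mobius_neg_mobius (a z : C) : (Cmod a < 1)%R -> (Cmod z <= 1)%R ->
  mobius (- a) (mobius a z) = z.
Proof.
intros ha hz; pose proof (mobius_den a z ha hz) as N.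
pose proof (one_minus_sqr_neq_0 a ha) as M.
unfold mobius; rewrite Copp_conj; field; split; [exact N|].
replace (1 + Cconj a * z + - Cconj a * (z + a)) with (1 - a * Cconj a) by ring; exact M.
Qed.

Lemma mobius_mobius_neg (a z : C) : (Cmod a < 1)%R -> (Cmod z <= 1)%R ->
  mobius a (mobius (- a) z) = z.
Proof.
intros ha hz; rewrite <- (mobius_neg_mobius (- a) z) at 2;
  [f_equal; ring|rewrite Cmod_opp; exact ha|exact hz].
Qed.

Lemma mobius_0_r (a : C) : mobius a 0 = a.
Proof. unfold mobius; field; replace (1 + Cconj a * 0) with (RtoC 1) by ring; exact C1_nz. Qed.

Lemma mobius_neg_self (a : C) : mobius (- a) a = 0.
Proof. unfold mobius; replace (a + - a) with (RtoC 0) by ring; unfold Cdiv; ring. Qed.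

Lemma bracket_mobius (z w : C) : bracket z w = mobius (- w) z.
Proof.
unfold bracket, mobius; rewrite Copp_conj; f_equal; ring.
Qed.

Lemma cderiv_mobius (a z : C) : 1 + Cconj a * z <> 0 ->
  cderiv (mobius a) z
    ((1 - a * Cconj a) / ((1 + Cconj a * z) * (1 + Cconj a * z))).
Proof.
intros N.
apply (cderiv_eq _ _ (((1 + 0) * (1 + Cconj a * z) - (z + a) * (0 + Cconj a * 1))
   / ((1 + Cconj a * z) * (1 + Cconj a * z)))); [|field; exact N].
apply (cderiv_div (fun w => w + a) (fun w => 1 + Cconj a * w)); [exact N| |].
- apply (cderiv_plus (fun w => w) (fun _ => a)); [apply cderiv_id|apply cderiv_const].
- apply (cderiv_plus (fun _ => RtoC 1) (fun w => Cconj a * w));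
    [apply cderiv_const|apply (cderiv_scal _ (fun w => w)), cderiv_id].
Qed.

(** * Closure properties of the Schur class and division by [T_(-z0)] *)

Lemma schur_cderiv (f : C -> C) (z : C) : schur_class f -> in_disc z ->
  exists l, cderiv f z l.
Proof. intros [H _] hz; apply ex_derive_cderiv, H, hz. Qed.

Lemma schur_intro (f : C -> C) : (forall z, in_disc z -> exists l, cderiv f z l) ->
  (forall z, in_disc z -> (Cmod (f z) <= 1)%R) -> schur_class f.
Proof. intros H1 H2; split; [intros z hz; apply ex_derive_cderiv, H1, hz|exact H2]. Qed.

Lemma schur_const (c : C) : (Cmod c <= 1)%R -> schur_class (fun _ => c).
Proof. intros hc; apply schur_intro; [exists 0; apply cderiv_const|auto]. Qed.

Lemma schur_ext (f g : C -> C) : eq_on_disc f g -> schur_class f -> schur_class g.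
Proof.
intros E Hf; apply schur_intro.
- intros z hz; destruct (schur_cderiv f z Hf hz) as [l Hl]; exists l.
  unfold in_disc in hz; apply (cderiv_ext_loc f g z l (1 - Cmod z)); [lra| |exact Hl].
  intros w hw; apply E; unfold in_disc.
  pose proof (Cmod_rev_triang w z); lra.
- intros z hz; rewrite <- E by exact hz; apply Hf, hz.
Qed.

Lemma schur_mobius (f : C -> C) (a : C) : (Cmod a < 1)%R -> schur_class f ->
  schur_class (fun z => mobius a (f z)).
Proof.
intros ha Hf; apply schur_intro.
- intros z hz; destruct (schur_cderiv f z Hf hz) as [l Hl]; eexists.
  apply (cderiv_comp (mobius a) f); [|exact Hl].
  apply cderiv_mobius, mobius_den; [exact ha|apply Hf, hz].
- intros z hz; apply mobius_le; [exact ha|apply Hf, hz].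
Qed.

Lemma schur_comp_mobius (f : C -> C) (a : C) : (Cmod a < 1)%R -> schur_class f ->
  schur_class (fun z => f (mobius a z)).
Proof.
intros ha Hf; apply schur_intro.
- intros z hz; destruct (schur_cderiv f (mobius a z) Hf) as [l Hl];
    [apply mobius_lt; assumption|].
  eexists; apply (cderiv_comp f (mobius a)); [exact Hl|].
  apply cderiv_mobius, mobius_den; [exact ha|apply Rlt_le, hz].
- intros z hz; apply Hf, mobius_lt; assumption.
Qed.

Lemma schur_mult (f g : C -> C) : schur_class f -> schur_class g ->
  schur_class (fun z => f z * g z).
Proof.
intros Hf Hg; apply schur_intro.
- intros z hz; destruct (schur_cderiv f z Hf hz) as [l Hl];
    destruct (schur_cderiv g z Hg hz) as [m Hm].
  eexists; apply (cderiv_mult f g); [exact Hl|exact Hm].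
- intros z hz; rewrite Cmod_mult; replace 1%R with (1 * 1)%R by ring.
  apply Rmult_le_compat; try apply Cmod_ge_0; [apply Hf, hz|apply Hg, hz].
Qed.

Lemma schur_id : schur_class (fun z => z).
Proof.
apply schur_intro; [exists 1; apply cderiv_id|intros z hz; apply Rlt_le, hz].
Qed.

Lemma schur_step (z0 c : C) (g : C -> C) : in_disc z0 -> (Cmod c < 1)%R ->
  schur_class g -> schur_class (fun z => mobius c (mobius (- z0) z * g z)).
Proof.
intros hz hc Hg.
apply (schur_mobius (fun z => mobius (- z0) z * g z) c hc), schur_mult; [|exact Hg].
apply (schur_mobius (fun z => z)); [rewrite Cmod_opp; exact hz|apply schur_id].
Qed.

Lemma schur_divide (z0 : C) (f : C -> C) : in_disc z0 -> schur_class f ->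
  (Cmod (f z0) < 1)%R -> exists q, schur_class q /\
    eq_on_disc f (fun z => mobius (f z0) (mobius (- z0) z * q z)).
Proof.
intros hz Hf hc.
assert (hz' : (Cmod (- z0) < 1)%R) by (rewrite Cmod_opp; exact hz).
destruct (schwarz_lemma (fun z => mobius (- f z0) (f (mobius z0 z)))) as [q [Hq E]].
- apply (schur_mobius (fun z => f (mobius z0 z))); [rewrite Cmod_opp; exact hc|].
  apply schur_comp_mobius; assumption.
- rewrite mobius_0_r; apply mobius_neg_self.
- exists (fun z => q (mobius (- z0) z)); split.
  + apply schur_comp_mobius; assumption.
  + intros z hzz.
    rewrite <- E by (apply mobius_lt; assumption).
    rewrite (mobius_mobius_neg z0 z) by (exact hz || apply Rlt_le, hzz).
    rewrite mobius_mobius_neg; [reflexivity|exact hc|apply Hf, hzz].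
Qed.

(* Schwarz-Pick for [lam * f], [lam < 1], gives in the limit
   [|f z - f z0| <= |T_(-z0) z| * |1 - conj (f z0) * f z| = |T_(-z0) z| * |f z0 - f z|]. *)
Lemma schur_unimodular (z0 : C) (f : C -> C) : in_disc z0 -> schur_class f ->
  Cmod (f z0) = 1%R -> eq_on_disc f (fun _ => f z0).
Proof.
intros h0 Hf hc z hz.
set (c := f z0) in *; set (X := Cmod (f z - c)); set (T := Cmod (mobius (- z0) z)).
assert (hT : (T < 1)%R) by (apply mobius_lt; [rewrite Cmod_opp; exact h0|exact hz]).
assert (hT0 : (0 <= T)%R) by apply Cmod_ge_0.
assert (hX : (0 <= X)%R) by apply Cmod_ge_0.
assert (Y : Cmod (1 - Cconj c * f z) = X).
{ replace (1 - Cconj c * f z) with (Cconj c * (c - f z)).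
  - rewrite Cmod_mult, Cmod_conj, hc, Rmult_1_l, Cmod_minus_sym; reflexivity.
  - pose proof (Cmod_sqr c) as Q; rewrite hc, Rmult_1_l in Q; rewrite Q; ring. }
assert (S : ((1 - T) * X <= 0)%R).
{ apply (Rle_0_of_le_mul _ (X + 2)); [lra|]; intros eps heps.
  destruct (Rle_lt_dec 1 eps) as [hb|hb]; [nra|].
  set (lam := (1 - eps)%R); assert (hl : (0 < lam < 1)%R) by (unfold lam; lra).
  assert (Hl : schur_class (fun w => RtoC lam * f w)).
  { apply (schur_mult (fun _ => RtoC lam)); [|exact Hf].
    apply schur_const; rewrite Cmod_R, Rabs_pos_eq; lra. }
  assert (hlc : (Cmod (RtoC lam * c) < 1)%R)
    by (rewrite Cmod_mult, hc, Cmod_R, Rabs_pos_eq; lra).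
  destruct (schur_divide z0 _ h0 Hl hlc) as [q [Hq E]].
  specialize (E z hz); simpl in E; fold c in E.
  assert (hq : (Cmod (mobius (- z0) z * q z) <= T)%R).
  { rewrite Cmod_mult; fold T; pose proof (proj2 Hq z hz); pose proof (Cmod_ge_0 (q z)).
    nra. }
  assert (E' : mobius (- (RtoC lam * c)) (RtoC lam * f z) = mobius (- z0) z * q z)
    by (rewrite E; apply mobius_neg_mobius; [exact hlc|lra]).
  assert (hlf : (Cmod (RtoC lam * f z) <= 1)%R) by (apply Hl, hz).
  assert (D := mobius_den (- (RtoC lam * c)) (RtoC lam * f z)
    ltac:(rewrite Cmod_opp; exact hlc) hlf).
  assert (F : RtoC lam * (f z - c)
    = mobius (- z0) z * q z * (1 + Cconj (- (RtoC lam * c)) * (RtoC lam * f z))).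
  { rewrite <- E'; unfold mobius; field; exact D. }
  apply (f_equal Cmod) in F; rewrite Cmod_mult, Cmod_R, Rabs_pos_eq in F by lra.
  rewrite Cmod_mult in F; fold X in F.
  assert (G : (Cmod (1 + Cconj (- (RtoC lam * c)) * (RtoC lam * f z)) <= X + 2 * eps)%R).
  { replace (1 + Cconj (- (RtoC lam * c)) * (RtoC lam * f z))
      with ((1 - Cconj c * f z) + RtoC (1 - lam * lam) * (Cconj c * f z)).
    - eapply Rle_trans; [apply Cmod_triangle|]; rewrite Y, !Cmod_mult, Cmod_conj, hc.
      rewrite Cmod_R, Rabs_pos_eq by nra.
      pose proof (proj2 Hf z hz); pose proof (Cmod_ge_0 (f z)).
      assert (1 - lam * lam <= 2 * eps)%R by (unfold lam; nra).
      assert (0 <= 1 - lam * lam)%R by nra.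
      nra.
    - rewrite Copp_conj, Cmult_conj, RtoC_minus, RtoC_mult.
      replace (Cconj (RtoC lam)) with (RtoC lam)
        by (unfold Cconj, RtoC; simpl; f_equal; ring).
      ring. }
  pose proof (Cmod_ge_0 (mobius (- z0) z * q z)).
  pose proof (Cmod_ge_0 (1 + Cconj (- (RtoC lam * c)) * (RtoC lam * f z))).
  assert (K : (lam * X <= T * (X + 2 * eps))%R)
    by (rewrite F; apply Rmult_le_compat; assumption).
  unfold lam in K; nra. }
assert (X0 : X = 0%R) by nra.
apply Cmod_eq_0 in X0.
replace (f z) with ((f z - c) + c) by ring; rewrite X0; ring.
Qed.

(** * The operator [Delta] and hyperbolic derivatives *)

Lemma not_unimodular_constant (z0 : C) (f : C -> C) : in_disc z0 ->
  (Cmod (f z0) < 1)%R -> ~ unimodular_constant f.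
Proof. intros h0 hc [c [hc1 H]]; rewrite (H z0 h0), hc1 in hc; lra. Qed.

(** Any representation of this form determines its inner function. Off [z0], applying [T_(-c)] and
    dividing by [T_(-z0)] recovers [g]. At [z0] the chain rule gives
    [f' = (1 - |c|^2) * g z0 / (1 - |z0|^2)], and the weights in the definition of [Delta] cancel
    exactly these factors. *)
Lemma Delta_step (z0 c : C) (f g : C -> C) : in_disc z0 -> (Cmod c < 1)%R ->
  schur_class g -> eq_on_disc f (fun z => mobius c (mobius (- z0) z * g z)) ->
  f z0 = c /\ eq_on_disc (Defs.Delta z0 f) g.
Proof.
intros h0 hc Hg E.
assert (hz' : (Cmod (- z0) < 1)%R) by (rewrite Cmod_opp; exact h0).
assert (Ec : f z0 = c)
  by (rewrite (E z0 h0), mobius_neg_self, Cmult_0_l; apply mobius_0_r).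
split; [exact Ec|]; intros z hz; unfold Defs.Delta.
destruct excluded_middle_informative as [U|_].
{ exfalso; revert U; apply (not_unimodular_constant z0); [exact h0|rewrite Ec; exact hc]. }
destruct (Ceq_dec z z0) as [->|N].
- destruct (schur_cderiv g z0 Hg h0) as [m Hm].
  pose proof (one_minus_sqr_neq_0 z0 h0) as N0; pose proof (one_minus_sqr_neq_0 c hc) as Nc.
  assert (den : 1 + Cconj (- z0) * z0 <> 0)
    by (apply mobius_den; [exact hz'|apply Rlt_le, h0]).
  assert (D1 := cderiv_mult (mobius (- z0)) g z0 _ m (cderiv_mobius (- z0) z0 den) Hm).
  assert (D2 : cderiv (mobius c) (mobius (- z0) z0 * g z0)
     ((1 - c * Cconj c) / ((1 + Cconj c * 0) * (1 + Cconj c * 0)))).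
  { rewrite mobius_neg_self, Cmult_0_l; apply cderiv_mobius, mobius_den; [exact hc|].
    rewrite Cmod_0; lra. }
  assert (D3 := cderiv_comp (mobius c) (fun z => mobius (- z0) z * g z) z0 _ _ D2 D1).
  unfold in_disc in h0.
  apply (cderiv_ext_loc _ f z0 _ (1 - Cmod z0)) in D3; [|lra|].
  2:{ intros w hw; symmetry; apply E; unfold in_disc.
      pose proof (Cmod_rev_triang w z0); lra. }
  rewrite (cderiv_C_derive _ _ _ D3), mobius_neg_self, Ec.
  rewrite !RtoC_minus, !Cmod2_conj, !Copp_conj.
  field; repeat split; try assumption.
- rewrite !bracket_mobius, Ec, (E z hz), mobius_neg_mobius; [|exact hc|].
  + field; intros Z.
    apply N; rewrite <- (mobius_mobius_neg z0 z); [|exact h0|apply Rlt_le, hz].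
    rewrite Z; apply mobius_0_r.
  + apply Rlt_le, Cmod_mult_lt_1; [apply mobius_lt; assumption|apply Hg, hz].
Qed.

Lemma Delta_divide (z0 : C) (f : C -> C) : in_disc z0 -> schur_class f ->
  (Cmod (f z0) < 1)%R -> schur_class (Defs.Delta z0 f) /\
    eq_on_disc f (fun z => mobius (f z0) (mobius (- z0) z * Defs.Delta z0 f z)).
Proof.
intros h0 Hf hc; destruct (schur_divide z0 f h0 Hf hc) as [q [Hq E]].
destruct (Delta_step z0 (f z0) f q h0 hc Hq E) as [_ D]; split.
- apply (schur_ext q); [intros z hz; symmetry; apply D, hz|exact Hq].
- intros z hz; rewrite (D z hz); apply E, hz.
Qed.

Lemma Delta_unimodular (z0 : C) (f : C -> C) : in_disc z0 -> schur_class f ->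
  Cmod (f z0) = 1%R -> forall z, Defs.Delta z0 f z = 0.
Proof.
intros h0 Hf hc z; unfold Defs.Delta.
destruct excluded_middle_informative as [_|N]; [reflexivity|].
exfalso; apply N; exists (f z0); split; [exact hc|].
apply (schur_unimodular z0 f h0 Hf hc).
Qed.

Lemma Delta_schur (z0 : C) (f : C -> C) : in_disc z0 -> schur_class f ->
  schur_class (Defs.Delta z0 f).
Proof.
intros h0 Hf; destruct (Rle_lt_or_eq_dec _ _ (proj2 Hf z0 h0)) as [hc|hc].
- apply Delta_divide; assumption.
- apply (schur_ext (fun _ => 0)); [|apply schur_const; rewrite Cmod_0; lra].
  intros z _; symmetry; apply Delta_unimodular; assumption.
Qed.

Lemma hyp_derive_S (j : nat) (f : C -> C) (z0 : C) :
  hyp_derive (S j) f z0 = hyp_derive j (Defs.Delta z0 f) z0.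
Proof. unfold hyp_derive; rewrite Nat.iter_succ_r; reflexivity. Qed.

(** The zero function is not a unimodular constant, so the convention for those does not settle the
    matter: it is a Schur step with [c = 0] and [g = 0], and [Delta] maps it to 0 again. This is
    known on the disc only, hence the quantification over all [f] vanishing there. *)
Lemma hyp_derive_zero (z0 : C) (j : nat) : in_disc z0 ->
  forall f, eq_on_disc f (fun _ => 0) -> hyp_derive j f z0 = 0.
Proof.
intros h0; induction j as [|j IH]; intros f E.
- apply (E z0 h0).
- rewrite hyp_derive_S; apply IH.
  apply (Delta_step z0 0 f (fun _ => 0) h0).
  + rewrite Cmod_0; lra.
  + apply schur_const; rewrite Cmod_0; lra.
  + intros z hz; rewrite (E z hz), Cmult_0_r, mobius_0_r; reflexivity.
Qed.

Lemma schur_interp_S (n : nat) (z0 : C) (gamma : nat -> C) (f : C -> C) :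
  in_disc z0 -> schur_interp (S n) z0 gamma f <->
  schur_class f /\ f z0 = gamma O
  /\ schur_interp n z0 (fun k => gamma (S k)) (Defs.Delta z0 f).
Proof.
intros h0; split.
- intros [Hf H]; repeat split; try apply Hf.
  + apply (H O); lia.
  + apply Delta_schur; assumption.
  + apply Delta_schur; assumption.
  + intros j hj; rewrite <- hyp_derive_S; apply H; lia.
- intros [Hf [H0 [_ H]]]; split; [exact Hf|].
  intros [|j] hj; [exact H0|rewrite hyp_derive_S; apply H; lia].
Qed.

(** * Polynomials and Blaschke products *)

(* [polyn d c f]: [f] is a polynomial function with coefficient [c] in degree [d]
   and none above; [c] may be zero. *)
Fixpoint polyn (d : nat) (c : C) (f : C -> C) : Prop :=
  match d with
  | O => forall z, f z = c
  | S d' => exists (c0 : C) (p : C -> C), polyn d' c p /\ forall z, f z = c0 + z * p z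
  end.

Lemma polyn_ext (d : nat) (c : C) (f g : C -> C) :
  (forall z, f z = g z) -> polyn d c f -> polyn d c g.
Proof.
intros E; destruct d as [|d]; simpl.
- intros H z; rewrite <- E; apply H.
- intros [c0 [p [Hp H]]]; exists c0, p; split; [exact Hp|].
  intros z; rewrite <- E; apply H.
Qed.

Lemma polyn_plus (d : nat) : forall (a b : C) (f g : C -> C),
  polyn d a f -> polyn d b g -> polyn d (a + b) (fun z => f z + g z).
Proof.
induction d as [|d IH]; intros a b f g; simpl.
- intros H1 H2 z; rewrite H1, H2; reflexivity.
- intros [c1 [p [Hp H1]]] [c2 [q [Hq H2]]].
  exists (c1 + c2), (fun z => p z + q z); split; [apply IH; assumption|].
  intros z; rewrite H1, H2; ring.
Qed.

Lemma polyn_scal (d : nat) (a : C) : forall (c : C) (f : C -> C),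
  polyn d c f -> polyn d (a * c) (fun z => a * f z).
Proof.
induction d as [|d IH]; intros c f; simpl.
- intros H z; rewrite H; reflexivity.
- intros [c0 [p [Hp H]]]; exists (a * c0), (fun z => a * p z); split; [apply IH, Hp|].
  intros z; rewrite H; ring.
Qed.

Lemma polyn_lift (d : nat) : forall (c : C) (f : C -> C),
  polyn d c f -> polyn (S d) 0 f.
Proof.
induction d as [|d IH]; intros c f.
- intros H; exists c, (fun _ => 0); split; [intros z; reflexivity|].
  intros z; rewrite (H z); ring.
- intros [c0 [p [Hp H]]]; exists c0, p; split; [apply (IH c), Hp|exact H].
Qed.

Lemma polyn_mul_linear (d : nat) (a b c : C) (f : C -> C) : polyn d c f ->
  polyn (S d) (a * c) (fun z => (a * z + b) * f z).
Proof.
intros H; replace (a * c) with (a * c + b * 0) by ring.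
apply (polyn_ext _ _ (fun z => a * (z * f z) + b * f z)); [intros z; ring|].
apply polyn_plus; apply polyn_scal.
- exists 0, f; split; [exact H|intros z; ring].
- apply (polyn_lift d c), H.
Qed.

Lemma polyn_cderiv (d : nat) : forall (c : C) (f : C -> C), polyn d c f ->
  forall z, exists l, cderiv f z l.
Proof.
induction d as [|d IH]; intros c f.
- intros H z; exists 0; apply (cderiv_ext_loc (fun _ => c) _ _ _ 1 Rlt_0_1);
    [intros w _; symmetry; apply H|apply cderiv_const].
- intros [c0 [p [Hp H]]] z; destruct (IH c p Hp z) as [l Hl]; eexists.
  apply (cderiv_ext_loc (fun z => c0 + z * p z) _ _ _ 1 Rlt_0_1);
    [intros w _; symmetry; apply H|].
  apply (cderiv_plus (fun _ => c0) (fun z => z * p z)); [apply cderiv_const|].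
  apply (cderiv_mult (fun z => z)); [apply cderiv_id|exact Hl].
Qed.

(** Horner's scheme: if [f z = c0 + z * p z] and [p z - p b = (z - b) * q z], the quotient for [f]
    is [p z + b * q z]. The leading coefficient is preserved, so it stays nonzero when factors are
    split off repeatedly. *)
Lemma polyn_sub_div (d : nat) (b : C) : forall (c : C) (f : C -> C),
  polyn (S d) c f -> exists q, polyn d c q /\ forall z, f z - f b = (z - b) * q z.
Proof.
induction d as [|d IH]; intros c f [c0 [p [Hp H]]].
- exists p; split; [exact Hp|]; intros z; rewrite !H, !Hp; ring.
- destruct (IH c p Hp) as [q [Hq E]].
  exists (fun z => p z + b * q z); split.
  + replace c with (c + 0) by ring; apply polyn_plus; [exact Hp|].
    apply (polyn_lift d (b * c)), polyn_scal, Hq.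
  + intros z; rewrite !H.
    replace (p z) with ((z - b) * q z + p b) by (rewrite <- E; ring); ring.
Qed.

(** Being bounded away from 0 near infinity, unlike growth, is also true in degree 0, so it can be
    proved by induction; one further factor [z] turns it into growth. *)
Lemma polyn_bounded_below (d : nat) (c : C) : c <> 0 -> forall f, polyn d c f ->
  exists m r : R, (0 < m)%R /\ (0 < r)%R /\
    forall z, (r <= Cmod z)%R -> (m <= Cmod (f z))%R.
Proof.
intros hc; induction d as [|d IH]; intros f.
- intros H; exists (Cmod c), 1%R; split; [apply Cmod_gt_0, hc|].
  split; [lra|]; intros z _; rewrite (H z); lra.
- intros [c0 [p [Hp H]]]; destruct (IH p Hp) as [m [r [hm [hr B]]]].
  pose proof (Cmod_ge_0 c0) as h0.
  exists 1%R, (Rmax r ((Cmod c0 + 1) / m)); split; [lra|].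
  split; [eapply Rlt_le_trans; [exact hr|apply Rmax_l]|].
  intros z hz.
  assert (h1 : (r <= Cmod z)%R) by (eapply Rle_trans; [apply Rmax_l|exact hz]).
  assert (h2 : ((Cmod c0 + 1) / m <= Cmod z)%R)
    by (eapply Rle_trans; [apply Rmax_r|exact hz]).
  apply (Rmult_le_compat_r m) in h2; [|lra].
  replace ((Cmod c0 + 1) / m * m)%R with (Cmod c0 + 1)%R in h2 by (field; lra).
  specialize (B z h1).
  assert (h3 : (Cmod z * m <= Cmod z * Cmod (p z))%R)
    by (apply Rmult_le_compat_l; [apply Cmod_ge_0|exact B]).
  rewrite (H z); replace (c0 + z * p z) with (z * p z + c0) by ring.
  pose proof (Cmod_rev_triang_plus (z * p z) c0) as T; rewrite Cmod_mult in T; lra.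
Qed.

Lemma polyn_tends_to_infinity (d : nat) (c : C) (f : C -> C) (M : R) :
  c <> 0 -> polyn (S d) c f ->
  exists r : R, (0 < r)%R /\ forall z, (r <= Cmod z)%R -> (M <= Cmod (f z))%R.
Proof.
intros hc [c0 [p [Hp H]]].
destruct (polyn_bounded_below d c hc p Hp) as [m [r [hm [hr B]]]].
exists (Rmax r ((Cmod c0 + M) / m)).
split; [eapply Rlt_le_trans; [exact hr|apply Rmax_l]|].
intros z hz.
assert (h1 : (r <= Cmod z)%R) by (eapply Rle_trans; [apply Rmax_l|exact hz]).
assert (h2 : ((Cmod c0 + M) / m <= Cmod z)%R)
  by (eapply Rle_trans; [apply Rmax_r|exact hz]).
apply (Rmult_le_compat_r m) in h2; [|lra].
replace ((Cmod c0 + M) / m * m)%R with (Cmod c0 + M)%R in h2 by (field; lra).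
specialize (B z h1).
assert (h3 : (Cmod z * m <= Cmod z * Cmod (p z))%R)
  by (apply Rmult_le_compat_l; [apply Cmod_ge_0|exact B]).
rewrite (H z); replace (c0 + z * p z) with (z * p z + c0) by ring.
pose proof (Cmod_rev_triang_plus (z * p z) c0) as T; rewrite Cmod_mult in T; lra.
Qed.

(** Without zeros, [1 / f] is differentiable everywhere, and on a large circle its modulus is at
    most half of its modulus at 0, against the maximum principle. *)
Lemma fundamental_theorem_of_algebra (d : nat) (c : C) (f : C -> C) :
  c <> 0 -> polyn (S d) c f -> exists b, f b = 0.
Proof.
intros hc Hf; apply NNPP; intros N.
assert (nz : forall z, f z <> 0) by (intros z E; apply N; exists z; exact E).
assert (D : forall z, exists l, cderiv (fun w => / f w) z l).
{ intros z; destruct (polyn_cderiv _ _ _ Hf z) as [l Hl]; eexists.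
  apply (cderiv_comp Cinv f); [apply cderiv_Cinv, nz|exact Hl]. }
set (M := Cmod (f 0)).
assert (hM : (0 < M)%R) by apply Cmod_gt_0, nz.
destruct (polyn_tends_to_infinity d c f (2 * M) hc Hf) as [r [hr B]].
assert (X : (Cmod (/ f 0) <= / (2 * M))%R).
{ apply (max_modulus (fun w => / f w) (r + 1) r).
  - lra.
  - rewrite Cmod_0; exact hr.
  - apply Rinv_0_lt_compat; lra.
  - intros z _; destruct (D z) as [l Hl]; exact (cderiv_ccont _ _ _ Hl).
  - intros z _ _; apply D.
  - intros z hz; rewrite Cmod_inv by apply nz.
    apply Rinv_le_contravar; [lra|apply B; lra]. }
rewrite Cmod_inv in X by apply nz; fold M in X.
assert (Y : (/ (2 * M) < / M)%R) by (apply Rinv_lt_contravar; nra).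
lra.
Qed.

(** * Products over lists and Moebius images of Blaschke products *)

Definition Cprod (h : C -> C) (l : list C) : C := List.fold_right Cmult 1 (List.map h l).

Lemma polyn_factor (d : nat) (c : C) : c <> 0 -> forall f, polyn d c f ->
  exists bs : list C, List.length bs = d /\
    forall z, f z = c * Cprod (fun b => z - b) bs.
Proof.
intros hc; induction d as [|d IH]; intros f Hf.
- exists nil; split; [reflexivity|]; intros z; rewrite (Hf z); unfold Cprod; simpl; ring.
- destruct (fundamental_theorem_of_algebra d c f hc Hf) as [b Hb].
  destruct (polyn_sub_div d b c f Hf) as [q [Hq E]].
  destruct (IH q Hq) as [bs [Hl Ebs]].
  exists (b :: bs)%list; split; [simpl; rewrite Hl; reflexivity|].
  intros z; replace (f z) with (f z - f b) by (rewrite Hb; ring).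
  rewrite E, Ebs; unfold Cprod; simpl; ring.
Qed.

Lemma Cprod_0_of_In (h : C -> C) (l : list C) (b : C) :
  List.In b l -> h b = 0 -> Cprod h l = 0.
Proof.
intros Hin Hb; induction l as [|x l IH]; [destruct Hin|].
unfold Cprod; simpl; destruct Hin as [->|Hin]; [rewrite Hb; ring|].
fold (Cprod h l); rewrite (IH Hin); ring.
Qed.

Lemma Cprod_neq_0 (h : C -> C) (l : list C) :
  (forall x, List.In x l -> h x <> 0) -> Cprod h l <> 0.
Proof.
induction l as [|x l IH]; intros H; unfold Cprod; simpl; [exact C1_nz|].
apply Cmult_neq_0; [apply H; left; reflexivity|].
apply IH; intros y hy; apply H; right; exact hy.
Qed.

Lemma Cprod_le (h k : C -> C) (l : list C) :
  (forall x, List.In x l -> (Cmod (h x) <= Cmod (k x))%R) ->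
  (Cmod (Cprod h l) <= Cmod (Cprod k l))%R.
Proof.
induction l as [|x l IH]; intros H; unfold Cprod; simpl; [lra|].
rewrite !Cmod_mult; apply Rmult_le_compat; try apply Cmod_ge_0.
- apply H; left; reflexivity.
- apply IH; intros y hy; apply H; right; exact hy.
Qed.

Lemma Cprod_conj (h : C -> C) (l : list C) :
  Cconj (Cprod h l) = Cprod (fun x => Cconj (h x)) l.
Proof.
induction l as [|x l IH]; unfold Cprod; simpl.
- unfold Cconj, RtoC; simpl; f_equal; ring.
- rewrite Cmult_conj; f_equal; exact IH.
Qed.

Lemma Cprod_scal (h k : C -> C) (w : C) (l : list C) :
  (forall x, List.In x l -> h x = w * k x) ->
  Cprod h l = w ^ List.length l * Cprod k l.
Proof.
induction l as [|x l IH]; intros H; unfold Cprod; simpl; [ring|].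
rewrite (H x (or_introl eq_refl)).
fold (Cprod h l) (Cprod k l).
rewrite IH by (intros y hy; apply H; right; exact hy); ring.
Qed.

Lemma Cprod_div (h k : C -> C) (l : list C) :
  (forall x, List.In x l -> k x <> 0) ->
  Cprod (fun x => h x / k x) l = Cprod h l / Cprod k l.
Proof.
intros H; induction l as [|x l IH]; unfold Cprod; simpl; [field; exact C1_nz|].
fold (Cprod (fun x => h x / k x) l) (Cprod h l) (Cprod k l).
assert (Hx : k x <> 0) by (apply H; left; reflexivity).
assert (Hl : forall y, List.In y l -> k y <> 0) by (intros y hy; apply H; right; exact hy).
rewrite IH by exact Hl; pose proof (Cprod_neq_0 k l Hl); field; split; assumption.
Qed.

Lemma polyn_Cprod (al be : C -> C) (l : list C) :
  polyn (List.length l) (Cprod al l) (fun z => Cprod (fun x => al x * z + be x) l).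
Proof.
induction l as [|x l IH]; [intros z; reflexivity|].
apply (polyn_mul_linear _ (al x) (be x)), IH.
Qed.

Lemma blaschke_den (a z : C) : (Cmod a < 1)%R -> (Cmod z <= 1)%R ->
  1 - Cconj a * z <> 0.
Proof.
intros ha hz; replace (1 - Cconj a * z) with (1 + Cconj (- a) * z)
  by (rewrite Copp_conj; ring).
apply mobius_den; [rewrite Cmod_opp; exact ha|exact hz].
Qed.

Lemma blaschke_outside (a z : C) : (Cmod a < 1)%R -> (1 <= Cmod z)%R ->
  (Cmod (1 - Cconj a * z) <= Cmod (z - a))%R.
Proof.
intros ha hz.
pose proof (mobius_identity (- a) z) as I; rewrite Cmod_opp, Copp_conj in I.
replace (1 + - Cconj a * z) with (1 - Cconj a * z) in I by ring.
change (z + - a) with (z - a) in I.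
pose proof (Cmod_ge_0 a); pose proof (Cmod_ge_0 (z - a)).
pose proof (Cmod_ge_0 (1 - Cconj a * z)).
assert ((1 - Cmod a * Cmod a) * (Cmod z * Cmod z - 1) >= 0)%R
  by (apply Rle_ge, Rmult_le_pos; nra).
nra.
Qed.

(* Writing the Blaschke product as [u P / Q], the Moebius image is
   [N / (Q + conj c * u P)] with [N = u P + c Q].  The zeros of [N] lie in the disc
   since [|P| >= |Q|] outside it, and the denominator is, up to a constant, the
   reflection [z^m * conj (N (1 / conj z))] of [N]. *)
Lemma mobius_blaschke (u c : C) (l : list C) :
  Cmod u = 1%R -> (Cmod c < 1)%R -> List.Forall in_disc l ->
  exists (v : C) (bs : list C), Cmod v = 1%R /\ List.length bs = List.length l /\
    List.Forall in_disc bs /\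
    forall z, in_disc z ->
      mobius c (u * Cprod (fun a => (z - a) / (1 - Cconj a * z)) l)
      = v * Cprod (fun b => (z - b) / (1 - Cconj b * z)) bs.
Proof.
intros hu hc Hl.
assert (Hin : forall a, List.In a l -> (Cmod a < 1)%R)
  by (intros a ha; rewrite List.Forall_forall in Hl; apply (Hl a ha)).
set (P := fun z => Cprod (fun a => z - a) l).
set (Q := fun z => Cprod (fun a => 1 - Cconj a * z) l).
set (q := Cprod (fun a => - Cconj a) l).
(* Leading coefficient of [N], with the product of ones left as [polyn_Cprod] produces it. It is
   nonzero because [|c * q| < 1 = |u|], so [N] has full degree and as many zeros as [l] has
   entries. *)
set (kappa := u * Cprod (fun _ => 1) l + c * q).
assert (uu : u * Cconj u = 1) by (rewrite <- Cmod_sqr, hu; f_equal; ring).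
assert (p1 : Cprod (fun _ => 1) l = 1).
{ clear; induction l as [|x l IH]; unfold Cprod in *; simpl; [reflexivity|rewrite IH; ring]. }
assert (hq : (Cmod q <= 1)%R).
{ rewrite <- Cmod_1, <- p1; apply Cprod_le; intros x hx.
  rewrite Cmod_opp, Cmod_conj, Cmod_1; left; apply Hin, hx. }
assert (hk : kappa <> 0).
{ apply Cmod_gt_0; unfold kappa; rewrite p1, Cmult_1_r.
  pose proof (Cmod_rev_triang_plus u (c * q)) as T; rewrite hu in T.
  pose proof (Cmod_mult_lt_1 c q hc hq); lra. }
assert (HN : polyn (List.length l) kappa (fun z => u * P z + c * Q z)).
{ apply polyn_plus; apply polyn_scal.
  - apply (polyn_ext _ _ (fun z => Cprod (fun a => 1 * z + - a) l)); [|apply polyn_Cprod].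
    intros z; unfold P, Cprod; do 2 f_equal; apply functional_extensionality; intros; ring.
  - apply (polyn_ext _ _ (fun z => Cprod (fun a => - Cconj a * z + 1) l));
      [|apply (polyn_Cprod (fun a => - Cconj a) (fun _ => 1))].
    intros z; unfold Q, Cprod; do 2 f_equal; apply functional_extensionality; intros; ring. }
destruct (polyn_factor _ kappa hk _ HN) as [bs [Hlen EN]]; simpl in EN.
(* At a zero with [|b| >= 1] one would have [|P b| = |c| * |Q b| <= |c| * |P b|] with [P b]
   nonzero. *)
assert (hbs : forall b, List.In b bs -> (Cmod b < 1)%R).
{ intros b hb; apply Rnot_le_lt; intros h1.
  assert (Z := EN b); rewrite (Cprod_0_of_In _ bs b hb) in Z by ring.
  rewrite Cmult_0_r in Z.
  assert (E : u * P b = - (c * Q b))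
    by (replace (u * P b) with ((u * P b + c * Q b) - c * Q b) by ring; rewrite Z; ring).
  apply (f_equal Cmod) in E; rewrite Cmod_opp, !Cmod_mult, hu, Rmult_1_l in E.
  assert (L : (Cmod (Q b) <= Cmod (P b))%R)
    by (apply Cprod_le; intros x hx; apply blaschke_outside; [apply Hin, hx|exact h1]).
  assert (nz : P b <> 0).
  { apply Cprod_neq_0; intros x hx; apply Cminus_neq_0; intros Eb.
    specialize (Hin x hx); rewrite Eb in h1; lra. }
  apply Cmod_gt_0 in nz; pose proof (Cmod_ge_0 c); pose proof (Cmod_ge_0 (Q b)); nra. }
assert (ck : Cconj kappa <> 0)
  by (apply Cmod_gt_0; rewrite Cmod_conj; apply Cmod_gt_0, hk).
assert (u0 : u <> 0) by (apply Cmod_gt_0; lra).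
assert (den : forall z,
  Q z + Cconj c * (u * P z) = u * Cconj kappa * Cprod (fun b => 1 - Cconj b * z) bs).
(* The reflected point [1 / conj z] does not exist for [z = 0]; there the identity is checked
   directly, both sides being [1 + conj c * u * P 0]. *)
{ intros z; destruct (Ceq_dec z 0) as [->|hz].
  - replace (Cprod (fun b => 1 - Cconj b * 0) bs) with (RtoC 1).
    + replace (Q 0) with (RtoC 1).
      * unfold kappa; rewrite p1, Cplus_conj, !Cmult_conj; unfold q; rewrite Cprod_conj.
        replace (Cprod (fun x => Cconj (- Cconj x)) l) with (P 0).
        -- replace (Cconj 1) with (RtoC 1) by (unfold Cconj, RtoC; simpl; f_equal; ring).
           transitivity (u * Cconj u + Cconj c * (u * P 0)); [rewrite uu; ring|ring].
        -- unfold P, Cprod; do 2 f_equal; apply functional_extensionality; intros x.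
           rewrite Copp_conj, Cconj_conj; ring.
      * symmetry; rewrite <- p1; unfold Q, Cprod; do 2 f_equal;
          apply functional_extensionality; intros; ring.
    + clear; induction bs as [|x bs IH]; unfold Cprod in *; simpl; [reflexivity|].
      rewrite <- IH; ring.
  - set (w := / Cconj z).
    assert (cz : Cconj z <> 0)
      by (apply Cmod_gt_0; rewrite Cmod_conj; apply Cmod_gt_0, hz).
    assert (cw : Cconj w = / z)
      by (unfold w; rewrite Cinv_conj by exact cz; rewrite Cconj_conj; reflexivity).
    assert (c1 : Cconj 1 = 1) by (unfold Cconj, RtoC; simpl; f_equal; ring).
    rewrite (Cprod_scal _ (fun b => Cconj (w - b)) z).
    2:{ intros b _; rewrite Cminus_conj, cw; field; exact hz. }
    unfold Q; rewrite (Cprod_scal _ (fun b => Cconj (w - b)) z).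
    2:{ intros b _; rewrite Cminus_conj, cw; field; exact hz. }
    unfold P; rewrite (Cprod_scal (fun a => z - a) (fun a => Cconj (1 - Cconj a * w)) z).
    2:{ intros b _; rewrite Cminus_conj, Cmult_conj, Cconj_conj, cw, c1; field; exact hz. }
    rewrite <- (Cprod_conj (fun b => w - b) l), <- (Cprod_conj (fun b => w - b) bs),
      <- (Cprod_conj (fun a => 1 - Cconj a * w) l), Hlen.
    assert (EW := f_equal Cconj (EN w)).
    rewrite Cplus_conj, !Cmult_conj in EW; unfold P, Q in EW.
    replace (u * Cconj kappa
      * (z ^ List.length l * Cconj (Cprod (fun b => w - b) bs)))
      with (u * z ^ List.length l * (Cconj kappa * Cconj (Cprod (fun b => w - b) bs)))
      by ring.
    rewrite <- EW.
    match goal with |- ?m * ?x + Cconj c * (u * (?m * ?y)) = _ =>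
      transitivity (m * ((u * Cconj u) * x + u * Cconj c * y)) end;
      [rewrite uu; ring|ring]. }
(* The quotient of the constants in front of the factored numerator and denominator; it is
   unimodular because [|u| = 1] and [|conj kappa| = |kappa|]. *)
exists (kappa / (u * Cconj kappa)), bs; split; [|split; [exact Hlen|split]].
- rewrite Cmod_div, Cmod_mult, hu, Cmod_conj by (apply Cmult_neq_0; assumption).
  apply Cmod_gt_0 in hk; field; lra.
- apply List.Forall_forall; exact hbs.
- intros z hz; pose proof (Rlt_le _ _ hz) as hz'.
  assert (Qz : Q z <> 0)
    by (apply Cprod_neq_0; intros x hx; apply blaschke_den; [apply Hin, hx|exact hz']).
  assert (Bz : Cprod (fun b => 1 - Cconj b * z) bs <> 0)
    by (apply Cprod_neq_0; intros x hx; apply blaschke_den; [apply hbs, hx|exact hz']).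
  assert (Dz := den z).
  assert (Dnz : Q z + Cconj c * (u * P z) <> 0)
    by (rewrite Dz; repeat apply Cmult_neq_0; assumption).
  rewrite (Cprod_div (fun a => z - a) (fun a => 1 - Cconj a * z))
    by (intros x hx; apply blaschke_den; [apply Hin, hx|exact hz']).
  rewrite (Cprod_div (fun a => z - a) (fun a => 1 - Cconj a * z))
    by (intros x hx; apply blaschke_den; [apply hbs, hx|exact hz']).
  fold (P z) (Q z).
  transitivity ((u * P z + c * Q z) / (Q z + Cconj c * (u * P z))).
  + unfold mobius; field; repeat split; try assumption.
  + rewrite EN, Dz; field; repeat split; assumption.
Qed.

Lemma unimodular_angle (c : C) : Cmod c = 1%R ->
  exists theta : R, c = (cos theta, sin theta).
Proof.
intros hc; destruct c as [x y].
assert (E : (x * x + y * y = 1)%R).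
{ pose proof (Cmod2_alt (x, y)) as X; rewrite hc in X; simpl in X; lra. }
assert (hx : (-1 <= x <= 1)%R) by nra.
assert (S : sqrt (1 - x²) = Rabs y).
{ replace (1 - x²)%R with (y²)%R by (unfold Rsqr; lra); apply sqrt_Rsqr_abs. }
destruct (Rle_lt_dec 0 y) as [hy|hy].
- exists (acos x); rewrite cos_acos, sin_acos, S, Rabs_pos_eq by assumption; reflexivity.
- exists (- acos x)%R; rewrite cos_neg, sin_neg, cos_acos, sin_acos, S by assumption.
  rewrite Rabs_left by exact hy; f_equal; ring.
Qed.

Lemma Cmod_cos_sin (t : R) : Cmod (cos t, sin t) = 1%R.
Proof.
rewrite <- (Cmod_circ 1 t) by lra; unfold circ; do 2 f_equal; ring.
Qed.

(** The factor [T_(-z0)] adds the zero [z0] and raises the degree by one, while the outer Moebius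
    map moves the zeros but keeps their number. The innermost unimodular constant has degree 0. *)
Lemma schur_nest_blaschke (z0 : C) (j : nat) : in_disc z0 -> forall gamma : nat -> C,
  (forall k, (k < j)%nat -> (Cmod (gamma k) < 1)%R) -> Cmod (gamma j) = 1%R ->
  blaschke_product j (schur_nest z0 gamma j (fun _ => gamma j)).
Proof.
intros h0; induction j as [|j IH]; intros gamma Hlt Heq.
- destruct (unimodular_angle _ Heq) as [theta E].
  exists theta, nil; split; [reflexivity|split; [constructor|]].
  intros z _; simpl; rewrite <- E; ring.
- destruct (IH (fun k => gamma (S k))) as [theta [a [Ha [Hd E]]]];
    [intros k hk; apply Hlt; lia|exact Heq|].
  destruct (mobius_blaschke (cos theta, sin theta) (gamma O) (z0 :: a))
    as [v [bs [Hv [Hlen [Hbs F]]]]];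
    [apply Cmod_cos_sin|apply Hlt; lia|constructor; assumption|].
  destruct (unimodular_angle v Hv) as [phi Ephi].
  exists phi, bs; split; [rewrite Hlen; simpl; rewrite Ha; reflexivity|].
  split; [exact Hbs|]; intros z hz.
  rewrite <- Ephi; change (List.fold_right Cmult 1 (List.map ?h bs)) with (Cprod h bs).
  rewrite <- (F z hz); simpl; rewrite (E z hz); f_equal.
  unfold Cprod; simpl.
  replace (mobius (- z0) z) with ((z - z0) / (1 - Cconj z0 * z)); [ring|].
  unfold mobius; rewrite Copp_conj; f_equal; ring.
Qed.

(** * The Schur algorithm *)

Lemma schur_nest_schur (z0 : C) (g : C -> C) (m : nat) : in_disc z0 -> schur_class g ->
  forall gamma : nat -> C, (forall k, (k < m)%nat -> (Cmod (gamma k) < 1)%R) ->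
  schur_class (schur_nest z0 gamma m g).
Proof.
intros h0 Hg; induction m as [|m IH]; intros gamma H; [exact Hg|].
apply (schur_step z0 (gamma O) (schur_nest z0 (fun k => gamma (S k)) m g) h0);
  [apply H; lia|apply IH; intros k hk; apply H; lia].
Qed.

Lemma mobius_step_congr (z0 : C) (gamma : nat -> C) (g h f : C -> C) :
  eq_on_disc g h ->
  eq_on_disc f (fun z => mobius (gamma O) (mobius (- z0) z * g z)) ->
  eq_on_disc f (fun z => mobius (gamma O) (mobius (- z0) z * h z)).
Proof. intros E F z hz; rewrite <- (E z hz); apply F, hz. Qed.

(** The parameter [fstar] obtained from [f] is its [(n + 1)]-fold [Delta]. The prescribed values use
    the iterates of order 0 to [n] only, so this last iterate is free; this is why the nesting has
    depth [S n]. *)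
Lemma schur_interp_interior (z0 : C) (n : nat) : in_disc z0 ->
  forall gamma : nat -> C, all_interior n gamma -> forall f : C -> C,
  schur_interp n z0 gamma f <->
  exists fstar, schur_class fstar /\ eq_on_disc f (schur_nest z0 gamma (S n) fstar).
Proof.
intros h0; induction n as [|n IH]; intros gamma Hg f.
- assert (hc := Hg O (le_n O)); split.
  + intros [Hf H]; assert (E : f z0 = gamma O) by apply (H O (le_n O)).
    rewrite <- E in hc; destruct (Delta_divide z0 f h0 Hf hc) as [Hd D].
    rewrite E in D; exists (Defs.Delta z0 f); split; [exact Hd|exact D].
  + intros [g [Hs E]].
    destruct (Delta_step z0 (gamma O) f g h0 hc Hs E) as [E0 _].
    split.
    * apply (schur_ext (schur_nest z0 gamma 1 g)); [intros z hz; symmetry; apply E, hz|].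
      apply schur_step; assumption.
    * intros j hj; replace j with O by lia; exact E0.
- assert (hc := Hg O ltac:(lia)).
  assert (Hg' : all_interior n (fun k => gamma (S k))) by (intros k hk; apply Hg; lia).
  rewrite schur_interp_S by exact h0; split.
  + intros [Hf [E H]].
    apply (IH _ Hg') in H; destruct H as [g [Hs D]]; exists g; split; [exact Hs|].
    rewrite <- E in hc; destruct (Delta_divide z0 f h0 Hf hc) as [_ F].
    rewrite E in F; exact (mobius_step_congr z0 gamma _ _ f D F).
  + intros [g [Hs E]].
    assert (Hn : schur_class (schur_nest z0 (fun k => gamma (S k)) (S n) g))
      by (apply schur_nest_schur; [exact h0|exact Hs|intros k hk; apply Hg'; lia]).
    destruct (Delta_step z0 (gamma O) f _ h0 hc Hn E) as [E0 D].
    split; [|split; [exact E0|]].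
    * apply (schur_ext (schur_nest z0 gamma (S (S n)) g));
        [intros z hz; symmetry; apply E, hz|apply (schur_step z0 (gamma O) _ h0 hc Hn)].
    * apply (IH _ Hg'); exists g; split; [exact Hs|exact D].
Qed.

(** Serves twice: as the base case of the boundary description and, through the forced zeros, in the
    exclusion of all other data. *)
Lemma schur_interp_unimodular (n : nat) (z0 : C) (gamma : nat -> C) (f : C -> C) :
  in_disc z0 -> schur_interp n z0 gamma f -> Cmod (gamma O) = 1%R ->
  eq_on_disc f (fun _ => gamma O) /\
  forall k, (0 < k <= n)%nat -> gamma k = 0.
Proof.
intros h0 [Hf H] hc.
assert (E : f z0 = gamma O) by (apply (H O); lia).
rewrite <- E in hc; split.
- intros z hz; rewrite <- E; apply (schur_unimodular z0 f h0 Hf hc z hz).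
- intros [|k] hk; [lia|]; rewrite <- (H (S k)) by lia; rewrite hyp_derive_S.
  apply hyp_derive_zero; [exact h0|].
  intros z _; apply Delta_unimodular; assumption.
Qed.

(** Induction on [j] with [n] and [gamma] left general, because one Schur step shortens the data and
    moves the unimodular entry one place forward. At [j = 0] the function is a unimodular constant
    and the convention [Delta = 0] yields the zeros that follow. *)
Lemma schur_interp_boundary (z0 : C) (j : nat) : in_disc z0 ->
  forall (n : nat) (gamma : nat -> C), boundary_at n gamma j -> forall f : C -> C,
  schur_interp n z0 gamma f <->
  eq_on_disc f (schur_nest z0 gamma j (fun _ => gamma j)).
Proof.
intros h0; induction j as [|j IH]; intros n gamma [hjn [Hlt [Heq Hz]]] f.
- split.
  + intros H; apply (schur_interp_unimodular n z0 gamma f h0 H Heq).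
  + intros E.
    assert (Hf : schur_class f).
    { apply (schur_ext (fun _ => gamma O)); [intros z hz; symmetry; apply E, hz|].
      apply schur_const; lra. }
    assert (E0 : f z0 = gamma O) by apply (E z0 h0).
    split; [exact Hf|]; intros [|k] hk; [exact E0|].
    rewrite (Hz (S k)) by lia; rewrite hyp_derive_S.
    apply hyp_derive_zero; [exact h0|]; intros z _.
    apply Delta_unimodular; [exact h0|exact Hf|rewrite E0; exact Heq].
- destruct n as [|n]; [lia|].
  assert (hc := Hlt O ltac:(lia)).
  assert (Hb : boundary_at n (fun k => gamma (S k)) j).
  { split; [lia|split; [intros k hk; apply Hlt; lia|split; [exact Heq|]]].
    intros k hk; apply Hz; lia. }
  assert (Hn : schur_class (schur_nest z0 (fun k => gamma (S k)) j (fun _ => gamma (S j)))).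
  { apply schur_nest_schur; [exact h0|apply schur_const; lra|].
    intros k hk; apply Hlt; lia. }
  rewrite schur_interp_S by exact h0; split.
  + intros [Hf [E H]].
    apply (IH n _ Hb) in H.
    rewrite <- E in hc; destruct (Delta_divide z0 f h0 Hf hc) as [_ F].
    rewrite E in F; exact (mobius_step_congr z0 gamma _ _ f H F).
  + intros E; destruct (Delta_step z0 (gamma O) f _ h0 hc Hn E) as [E0 D].
    split; [|split; [exact E0|apply (IH n _ Hb), D]].
    apply (schur_ext (schur_nest z0 gamma (S j) (fun _ => gamma (S j))));
      [intros z hz; symmetry; apply E, hz|apply (schur_step z0 (gamma O) _ h0 hc Hn)].
Qed.

(** The empty case by contraposition: a single interpolant already forces one of the two patterns.
    If [|f z0| = 1] the pattern is a boundary one with [j = 0]; otherwise it is the pattern of the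
    data of [Delta z0 f], shifted by one. *)
Lemma schur_interp_dichotomy (z0 : C) (n : nat) : in_disc z0 ->
  forall (gamma : nat -> C) (f : C -> C), schur_interp n z0 gamma f ->
  all_interior n gamma \/ exists j, boundary_at n gamma j.
Proof.
intros h0; induction n as [|n IH]; intros gamma f H.
all: assert (E : f z0 = gamma O) by (apply (proj2 H O); lia).
all: assert (hle := proj2 (proj1 H) z0 h0); rewrite E in hle.
all: destruct (Rle_lt_or_eq_dec _ _ hle) as [hlt|heq];
  [|right; exists O; split; [lia|split; [lia|split; [exact heq|]]];
    apply (schur_interp_unimodular _ z0 gamma f h0 H heq)].
- left; intros k hk; replace k with O by lia; exact hlt.
- apply schur_interp_S in H; [|exact h0]; destruct H as [_ [_ H]].
  destruct (IH _ _ H) as [Hi|[j [h1 [h2 [h3 h4]]]]].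
  + left; intros [|k] hk; [exact hlt|apply Hi; lia].
  + right; exists (S j); split; [lia|split; [|split; [exact h3|]]].
    * intros [|k] hk; [exact hlt|apply h2; lia].
    * intros [|k] hk; [lia|apply h4; lia].
Qed.

Theorem theorem3p1 (n : nat) (z0 : C) (gamma : nat -> C)
  (hz0 : in_disc z0)
  (hgamma : forall k : nat, (k <= n)%nat -> in_closed_disc (gamma k)) :
  (all_interior n gamma ->
     forall f : C -> C,
       schur_interp n z0 gamma f <->
       exists fstar : C -> C,
         schur_class fstar /\
         eq_on_disc f (schur_nest z0 gamma (S n) fstar))
  /\
  (forall j : nat, boundary_at n gamma j ->
     (forall f : C -> C,
        schur_interp n z0 gamma f <->
        eq_on_disc f (schur_nest z0 gamma j (fun _ => gamma j))) /\
     blaschke_product j (schur_nest z0 gamma j (fun _ => gamma j)))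
  /\
  (~ all_interior n gamma ->
   ~ (exists j : nat, boundary_at n gamma j) ->
     forall f : C -> C, ~ schur_interp n z0 gamma f).
Proof.
split; [|split].
- apply schur_interp_interior, hz0.
- intros j Hj; split; [apply schur_interp_boundary; assumption|].
  destruct Hj as [_ [Hlt [Heq _]]]; apply schur_nest_blaschke; assumption.
- intros N1 N2 f Hf; destruct (schur_interp_dichotomy z0 n hz0 gamma f Hf); auto.
Qed.
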